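(* For every $L_F\ge\mu_F>0$, $\chi_A\ge 1$, and $\tilde\lambda_{\min}^+>0$, $\tilde\lambda_{\max}>0$ with $\tilde\lambda_{\max}/\tilde\lambda_{\min}^+=\chi_W\ge3$, there exist a decentralized affine-constrained problem $$\min_{x_1,\dots,x_n}\ \sum_{i=1}^n f_i(x_i)\quad\text{s.t. } A_ix_i=b_i\ (i=1,\dots,n),\quad x_1=\dots=x_n,$$ with each $f_i$ $L_F$-smooth and $\mu_F$-strongly convex, initial points $x_i^0$, a sequence of communication graphs $G(k)=(V,E(k))$ on the agents $V=\{1,\dots,n\}$ with gossip matrices $W(k)$ satisfying $$\tilde\lambda_{\min}^+\le\lambda_{\min}^+(W(k))\le\lambda_{\max}(W(k))\le\tilde\lambda_{\max}\quad\text{for all }k,$$ and with the matrix $\mathbf A=\mathrm{diag}(A_1,\dots,A_n)$ satisfying $\lambda_{\max}(\mathbf A^\top\mathbf A)/\lambda_{\min}^+(\mathbf A^\top\mathbf A)=\chi_A$, such that any first-order decentralized algorithm (as defined in the context) requires at least $$N=\Theta\Big(\sqrt{L_F/\mu_F}\,\log\tfrac1\varepsilon\Big)\ \text{sequential local computations},$$ $$\Theta\big(N\chi_W\big)\ \text{communications},\qquad \Theta\big(N\sqrt{\chi_A}\big)\ \text{multiplications by }\mathbf A^\top\mathbf A$$ to produce approximate solutions $x_i$ with $\|x_i-x^*\|^2\le\varepsilon$ for all $i\in\{1,\dots,n\}$, where $x_1=\dots=x_n=x^*$ is the solution of the problem.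
   Context: Setting: $n$ agents; agent $i$ privately holds $f_i$, $A_i$, $b_i$. The local variables $x_i$ live in $\mathbb R^d$; for the lower bounds $d=\infty$ is allowed (the space $\ell_2$ of square-summable sequences, matrices being bounded linear operators). A differentiable $f$ is $\mu$-strongly convex if $f(y)\ge f(x)+\langle\nabla f(x),y-x\rangle+\frac\mu2\|y-x\|^2$ and $L$-smooth if $f(y)\le f(x)+\langle\nabla f(x),y-x\rangle+\frac L2\|y-x\|^2$ for all $x,y$. $f^*$ is the Fenchel conjugate. $\lambda_{\max}$ and $\lambda_{\min}^+$ are the largest and the smallest positive eigenvalue. Gossip matrix: an $n\times n$ matrix $W$ is a gossip matrix of an undirected graph $G=(V,E)$, $|V|=n$, if (1) $W$ is symmetric positive semidefinite; (2) $[W]_{ij}\ne0$ iff $(i,j)\in E$ or $i=j$; (3) $Wv=0$ iff $v_1=\dots=v_n$. $W(k)$ is a gossip matrix of $G(k)$, the communication graph at step $k$. First-order decentralized algorithm: agent $i$ has a local memory $\mathcal M_i(k)$ at step $k$, with $\mathcal M_i(0)=\{x_i^0\}$. At step $k$ the allowed actions are the following three memory updates: (1) local computation: $\mathcal M_i(k)=\mathrm{span}(\{x,\nabla f_i(x),\nabla f_i^*(x): x\in\mathcal M_i(k)\})$; (2) decentralized communication: $\mathcal M_i(k)=\mathrm{span}(\{\mathcal M_j(k): (i,j)\in E(k)\})$; (3) matrix multiplication: $\mathcal M_i(k)=\mathrm{span}(\{b_i,A_i^\top A_ix: x\in\mathcal M_i(k)\})$. (In each formula, the right-hand side uses the memory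 before the action.) After each step $k$ the algorithm must provide a current approximate solution $x_i^k\in\mathcal M_i(k)$ and sets $\mathcal M_i(k+1)=\mathcal M_i(k)$. The numbers of sequential local computations, communications and multiplications count the actions of types (1), (2) and (3). $\Theta$ is standard order notation with absolute constants (independent of $L_F,\mu_F,\chi_W,\chi_A,\varepsilon$), in the regime of small $\varepsilon$ (how small may depend on the problem instance) and large $L_F/\mu_F$.
   Formalization: The communication graph G(k) is that of the k-th communication rather than of the k-th step: if the graph also changed during other actions, an algorithm could idle until one graph recurs and need only about N√χ_W communications. *)

(* Defs.v *)
From HB Require Import structures.
From mathcomp Require Import all_boot all_order all_algebra.
From mathcomp Require Import all_classical all_reals all_analysis.
From mathcomp Require Import ring lra.

Set Implicit Arguments.
Unset Strict Implicit.
Unset Printing Implicit Defensive.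

Import Order.TTheory GRing.Theory Num.Theory.
Import numFieldNormedType.Exports.

Local Open Scope classical_set_scope.
Local Open Scope ring_scope.

Section SquareSummable.
Variable R : realType.
Implicit Types u v : nat -> R.

Definition square_summable : {pred (nat -> R)} :=
  [pred u : nat -> R | `[< cvgn (series (fun k => u k ^+ 2)) >]].

Lemma square_summableP u :
  reflect (cvgn (series (fun k => u k ^+ 2))) (u \in square_summable).
Proof. exact: asboolP. Qed.

Lemma is_cvg_seriesMl a u : cvgn (series u) -> cvgn (series (fun k => a * u k)).
Proof. exact: (@is_cvg_seriesZ R u a). Qed.

Lemma is_cvg_series_add u v : cvgn (series u) -> cvgn (series v) ->
  cvgn (series (fun k => u k + v k)).
Proof. exact: (@is_cvg_seriesD R u v). Qed.

Lemma square_summable_submod_closed : submod_closed square_summable.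
Proof.
split.
  apply/square_summableP; rewrite (_ : series _ = cst 0); first exact: is_cvg_cst.
  apply/funext => n; rewrite /series /= big1// => k _.
  exact: (expr0n R 2).
move=> a u v /square_summableP hu /square_summableP hv; apply/square_summableP.
apply: (@series_le_cvg R _
  (fun k => 2 * a ^+ 2 * u k ^+ 2 + 2 * v k ^+ 2)).
- by move=> k; exact: sqr_ge0.
- by move=> k; rewrite addr_ge0// mulr_ge0 ?sqr_ge0// mulr_ge0 ?sqr_ge0.
- move=> k; rewrite -[(a *: u + v) k]/(a * u k + v k) -subr_ge0.
  rewrite (_ : _ - _ = (a * u k - v k) ^+ 2); first exact: sqr_ge0.
  by ring.
by apply: is_cvg_series_add; exact: is_cvg_seriesMl.
Qed.

HB.instance Definition _ :=
  GRing.isSubmodClosed.Build _ _ square_summable square_summable_submod_closed.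

Record l2 := L2 { l2_seq :> nat -> R; l2_seqP : l2_seq \in square_summable }.

HB.instance Definition _ := [isSub for l2_seq].
HB.instance Definition _ := [Choice of l2 by <:].
HB.instance Definition _ := [SubChoice_isSubLmodule of l2 by <:].

Definition inner (x y : l2) : R := limn (series (fun k => x k * y k)).

Lemma is_cvg_inner (x y : l2) : cvgn (series (fun k => x k * y k)).
Proof.
have /square_summableP cx := l2_seqP x; have /square_summableP cy := l2_seqP y.
apply: normed_cvg.
apply: (@series_le_cvg R _ (fun k => x k ^+ 2 + y k ^+ 2)).
- by move=> k; exact: normr_ge0.
- by move=> k; rewrite addr_ge0// sqr_ge0.
- move=> k; rewrite /= normrM -[x k ^+ 2]real_normK ?num_real//.
  rewrite -[y k ^+ 2]real_normK ?num_real//.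
  have := normr_ge0 (x k); have := normr_ge0 (y k).
  by set s := `|x k|; set t := `|y k| => t0 s0; nra.
exact: is_cvg_series_add.
Qed.

Lemma innerC (x y : l2) : inner x y = inner y x.
Proof. by rewrite /inner; under eq_fun do rewrite mulrC. Qed.

Lemma innerDZl a (x y z : l2) : inner (a *: x + y) z = a * inner x z + inner y z.
Proof.
have cx := @is_cvg_inner x z; have cy := @is_cvg_inner y z.
rewrite /inner -[a * _]/(a *: _) -(lim_seriesZ a cx).
rewrite -(lim_seriesD (@is_cvg_seriesZ R _ a cx) cy).
by congr (limn (series _)); apply/funext => k; rewrite /= mulrDl -mulrA.
Qed.

Lemma innerDl (x y z : l2) : inner (x + y) z = inner x z + inner y z.
Proof. by rewrite -[x in LHS]scale1r innerDZl mul1r. Qed.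

Lemma inner0l (z : l2) : inner 0 z = 0.
Proof. by apply: (addrI (inner 0 z)); rewrite -innerDl !addr0. Qed.

Lemma innerZl a (x z : l2) : inner (a *: x) z = a * inner x z.
Proof. by rewrite -[a *: x]addr0 innerDZl inner0l addr0. Qed.

Lemma le_sqr_inner (x : l2) k : x k ^+ 2 <= inner x x.
Proof.
apply: (@le_trans _ _ (series (fun k => x k * x k) k.+1)).
  rewrite /series /= big_nat_recr//= -expr2 lerDr sumr_ge0// => i _.
  exact: sqr_ge0.
apply: nondecreasing_cvgn_le (@is_cvg_inner x x) _.
by apply/nondecreasing_seqP => n; rewrite /series /= big_nat_recr//= lerDl sqr_ge0.
Qed.

Lemma inner_ge0 (x : l2) : 0 <= inner x x.
Proof. exact: le_trans (sqr_ge0 _) (le_sqr_inner x 0). Qed.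

Lemma inner_eq0 (x : l2) : inner x x = 0 -> x = 0.
Proof.
move=> x0; apply/val_inj/funext => k /=.
by apply/eqP; rewrite -sqrf_eq0 eq_le sqr_ge0 -x0 le_sqr_inner.
Qed.

Lemma inner_CauchySchwarz (x y : l2) :
  inner x y ^+ 2 <= inner x x * inner y y.
Proof.
have [y0|y0] := eqVneq (inner y y) 0.
  by rewrite (inner_eq0 y0) innerC !inner0l mulr0 expr0n.
have ypos : 0 < inner y y by rewrite lt_def y0 inner_ge0.
have := inner_ge0 (inner y y *: x + (- inner x y) *: y).
rewrite innerDZl innerC innerDZl innerZl [X in _ + X]innerZl.
rewrite [inner y (_ + _)]innerC innerDZl innerZl (innerC y x).
set p := inner x x; set q := inner y y in ypos *; set r := inner x y.
rewrite (_ : _ + _ = q * (p * q - r ^+ 2)); last by ring.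
by rewrite pmulr_rge0// subr_ge0.
Qed.

Definition l2_norm (x : l2) : R := Num.sqrt (inner x x).

Lemma l2_normD x y : l2_norm (x + y) <= l2_norm x + l2_norm y.
Proof.
rewrite -[leRHS]ger0_norm ?addr_ge0 ?sqrtr_ge0// -sqrtr_sqr ler_sqrt ?sqr_ge0//.
rewrite sqrrD !sqr_sqrtr ?inner_ge0// innerDl ![inner _ (x + y)]innerC !innerDl.
rewrite (innerC y x).
suff : inner x y <= l2_norm x * l2_norm y by rewrite /l2_norm mulr2n; lra.
rewrite -sqrtrM ?inner_ge0// (le_trans (ler_norm _))// -sqrtr_sqr.
by rewrite ler_wsqrtr// inner_CauchySchwarz.
Qed.

Lemma l2_normZ a x : l2_norm (a *: x) = `|a| * l2_norm x.
Proof.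
rewrite /l2_norm innerZl innerC innerZl mulrA -expr2 sqrtrM ?sqr_ge0//.
by rewrite sqrtr_sqr.
Qed.

Lemma l2_norm_eq0 x : l2_norm x = 0 -> x = 0.
Proof.
move/eqP; rewrite sqrtr_eq0 => x0; apply: inner_eq0.
by apply/eqP; rewrite eq_le x0 inner_ge0.
Qed.

HB.instance Definition _ :=
  Lmodule_isNormed.Build R l2 l2_normD l2_normZ l2_norm_eq0.

End SquareSummable.

Lemma l2_normE (R : realType) (x : l2 R) : `|x| = Num.sqrt (inner x x).
Proof. by []. Qed.

Section ConvexFunctions.
Variable R : realType.
Implicit Types (f : l2 R -> R) (x y g : l2 R).

(* [g] represents the Frechet differential of [f] at [x]. *)
Definition is_gradient f x g : Prop := is_diff x (f : l2 R -> R^o) (inner g).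

Definition has_gradient f : Prop := forall x, exists g, is_gradient f x g.

Definition strongly_convex (mu : R) f : Prop := has_gradient f /\
  forall x y g, is_gradient f x g ->
    f x + inner g (y - x) + mu / 2 * `|y - x| ^+ 2 <= f y.

Definition smooth (L : R) f : Prop := has_gradient f /\
  forall x y g, is_gradient f x g ->
    f y <= f x + inner g (y - x) + L / 2 * `|y - x| ^+ 2.

(* [sup] is real valued and returns 0 on unbounded sets; for a strongly convex
   [f] the set below is nonempty and bounded above, so no default is used. *)
Definition fenchel_conj f y : R := sup (range (fun x => inner y x - f x)).

Definition span (V : lmodType R) (S : set V) : set V :=
  [set v | exists (m : nat) (c : 'I_m -> R) (s : 'I_m -> V),
    (forall i, S (s i)) /\ v = \sum_(i < m) c i *: s i].

End ConvexFunctions.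

Section Eigenvalues.
Variable R : realType.

Definition is_maximum (S : set R) (a : R) : Prop := S a /\ forall b, S b -> b <= a.
Definition is_minimum (S : set R) (a : R) : Prop := S a /\ forall b, S b -> a <= b.

Definition mx_lambda_max n (W : 'M[R]_n) (a : R) : Prop :=
  is_maximum [set l | eigenvalue W l] a.

Definition mx_lambda_min_pos n (W : 'M[R]_n) (a : R) : Prop :=
  is_minimum [set l | eigenvalue W l /\ 0 < l] a.

Definition op_eigenvalue (V : lmodType R) (T : V -> V) (l : R) : Prop :=
  exists2 v : V, v != 0 & T v = l *: v.

Definition op_spectrum (V : lmodType R) (T : V -> V) : set R :=
  [set l | ~ bijective (fun v => T v - l *: v)].

(* An operator on an infinite-dimensional space may have spectral values which
   are not eigenvalues. The extreme values are required to be eigenvalues and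
   to be extreme in the whole (real) spectrum; on a finite-dimensional space
   the spectrum is the set of eigenvalues. *)
Definition op_lambda_max (V : lmodType R) (T : V -> V) (a : R) : Prop :=
  op_eigenvalue T a /\ is_maximum (op_spectrum T) a.

Definition op_lambda_min_pos (V : lmodType R) (T : V -> V) (a : R) : Prop :=
  op_eigenvalue T a /\ is_minimum [set l | op_spectrum T l /\ 0 < l] a.

End Eigenvalues.

Definition undirected_graph n (e : rel 'I_n) : Prop :=
  symmetric e /\ irreflexive e.

Definition gossip_matrix (R : realType) n (e : rel 'I_n) (W : 'M[R]_n) : Prop :=
  [/\ W^T = W /\ (forall v : 'cV[R]_n, 0 <= (v^T *m W *m v) ord0 ord0),
      forall i j, (W i j != 0) = (e i j || (i == j)) &
      forall v : 'cV[R]_n, W *m v = 0 <-> forall i j, v i ord0 = v j ord0].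

(* The matrices are bounded operators on [l2]; [adj i] is the transpose of
   [op i], which the adjunction identity determines uniquely. *)
Record affine_problem (R : realType) (n : nat) := AffineProblem {
  cost : 'I_n -> l2 R -> R;
  op : 'I_n -> {linear l2 R -> l2 R};
  adj : 'I_n -> l2 R -> l2 R;
  rhs : 'I_n -> l2 R;
  op_bounded : forall i, continuous (op i);
  op_adj : forall i x y, inner (op i x) y = inner x (adj i y)
}.

Section Problems.
Variables (R : realType) (n : nat) (P : affine_problem R n).

Definition feasible (x : 'I_n -> l2 R) : Prop :=
  (forall i, op P i (x i) = rhs P i) /\ (forall i j, x i = x j).

Definition is_solution (x : 'I_n -> l2 R) : Prop := feasible x /\
  forall y, feasible y -> \sum_(i < n) cost P i (x i) <= \sum_(i < n) cost P i (y i).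

(* [A^T A] for the block-diagonal [A = diag(A_1, ..., A_n)]. *)
Definition block_gram (x : 'I_n -> l2 R) : 'I_n -> l2 R :=
  fun i => adj P i (op P i (x i)).

End Problems.

Variant action := Computation | Communication | Multiplication.

Definition action_eqb (a b : action) : bool :=
  match a, b with
  | Computation, Computation
  | Communication, Communication
  | Multiplication, Multiplication => true
  | _, _ => false
  end.

Lemma action_eqP : Equality.axiom action_eqb.
Proof. by do 2!case; constructor. Qed.

HB.instance Definition _ := hasDecEq.Build action action_eqP.

Section Algorithms.
Variables (R : realType) (n : nat) (P : affine_problem R n).

(* [b_i] lives in the codomain of [A_i] while memories live in its domain. Here
   both spaces are [l2], and the memory receives [b_i] as well as [A_i^T b_i],
   the vector through which [b_i] enters first-order methods. *)
Definition memory_update (e : rel 'I_n) (a : action) (M : 'I_n -> set (l2 R))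
    (i : 'I_n) : set (l2 R) :=
  match a with
  | Computation => span [set y | exists2 x, M i x &
      [\/ y = x, is_gradient (cost P i) x y
        | is_gradient (fenchel_conj (cost P i)) x y]]
  | Communication => span [set y | exists2 j, e i j & M j y]
  | Multiplication => span [set y | [\/ y = rhs P i, y = adj P i (rhs P i)
      | exists2 x, M i x & y = adj P i (op P i x)]]
  end.

Definition nb_actions (act : nat -> action) (a : action) (K : nat) : nat :=
  \sum_(k < K) (act k == a).

(* [memory k] and [output k] are the memories and approximate solutions after
   [k] actions. A new memory may be any part of what is spanned by the old
   memory and its update: equality with the update, and agents which keep their
   old memory or skip an action, are special cases. The network changes from
   one communication to the next, not while agents compute: the communication
   preceded by [q] others uses [G q]. *)
Record algorithm_run (G : nat -> rel 'I_n) (x0 : 'I_n -> l2 R) := AlgorithmRun {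
  act : nat -> action;
  memory : nat -> 'I_n -> set (l2 R);
  output : nat -> 'I_n -> l2 R;
  memory0 : forall i, memory 0%N i = [set x0 i];
  memoryS : forall k i, memory k.+1 i `<=`
    span (memory k i `|`
      memory_update (G (nb_actions act Communication k)) (act k) (memory k) i);
  output_memory : forall k i, memory k i (output k i)
}.

End Algorithms.

Definition Theta_with (R : realType) (c C a b : R) : Prop := c * b <= a <= C * b.

(* Main.v *)
Require Import Defs.
From HB Require Import structures.
From mathcomp Require Import all_boot all_order all_algebra.
From mathcomp Require Import all_classical all_reals all_analysis.
From mathcomp Require Import ring lra zify.

Set Implicit Arguments.
Unset Strict Implicit.
Unset Printing Implicit Defensive.

Import Order.TTheory GRing.Theory Num.Theory.
Import numFieldNormedType.Exports.

Local Open Scope classical_set_scope.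
Local Open Scope ring_scope.

(** The theorem holds because progress towards the solution can only be made one
    coordinate at a time, and each new coordinate costs one local computation, a trip
    through a network whose center keeps changing, and a trip along a path that only
    multiplications by the Gram operator can travel.

    The variable is a sequence indexed by pairs of an index of an infinite chain and a
    block. There are [3 * s] agents with [s] about [chiW / 3], and [m = 3 * t - 1]
    blocks with [t] of the order of [sqrt chiA]. The constraint forces the [m] blocks
    to be equal: it is the incidence matrix of a path, whose Gram matrix has its
    positive spectrum between [1 / m ^ 2] and [4] ([path_eigen_bounds]); two
    auxiliary blocks fix the extreme eigenvalues so that their ratio is exactly
    [chiA] ([path_window], [hard_gram_spectrum]). Every cost is a multiple of the
    squared norm plus quadratic couplings of consecutive chain indices. The pairs
    [{1, 2}, {3, 4}, ...] are coupled by the first third of the agents in the first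
    [t] blocks, the pairs [{0, 1}, {2, 3}, ...] by the last third of the agents in
    the last [t] blocks, and a linear term feeds index [0]. On the feasible set the
    total cost is the classical quadratic chain of condition number of order
    [LF / muF], whose minimizer is the geometric sequence [rho ^+ k] with
    [- ln rho <= 12 / sqrt (LF / muF)] when [LF / muF] is large
    ([hard_solution_optimal], [chain_decay]).

    An algorithm started at zero only holds vectors that vanish beyond some level of
    the chain, which depends on the agent and on the block ([memory_below]). The
    gradients of a cost and of its conjugate preserve such supports up to the
    matching of the agent, because the Hessian is [mu + beta Q] with [Q ^ 2 = 2 Q],
    so that its inverse is also a combination of the identity and [Q]
    ([fenchel_quad_gradient]). Hence an agent holding one matching can raise the
    level by one, and then nothing moves until the other matching acts. The network
    is a star whose center runs through the middle third of the agents. Its gossip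
    matrix has positive eigenvalues [lmin] and [3 * s * lmin], and information
    entering from one outer third reaches only the successive centers until the first
    of them serves again, which takes [s] rounds ([communication_level]). Likewise a
    multiplication only moves information between neighbouring blocks, so [t] of them
    are needed to go from the first [t] blocks to the last [t]
    ([multiplication_level]). So the level is at most the number of computations, and
    at most one more than the number of communications over [s] and than the number of
    multiplications over [t].

    At level [K] the squared error is at least [rho ^+ (2 * K)] ([below_error]),
    so an error of at most [eps] requires [K] of order
    [sqrt (LF / muF) * ln (1 / eps)] ([reach_threshold]). *)

(** * Quadratic functions on square-summable sequences *)

Section InnerAlgebra.
Variable R : realType.
Implicit Types x y z : l2 R.

Lemma innerDr x y z : inner x (y + z) = inner x y + inner x z.
Proof. by rewrite innerC innerDl !(innerC _ x). Qed.

Lemma innerZr a x y : inner x (a *: y) = a * inner x y.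
Proof. by rewrite innerC innerZl innerC. Qed.

Lemma innerNl x y : inner (- x) y = - inner x y.
Proof. by rewrite -scaleN1r innerZl mulN1r. Qed.

Lemma innerNr x y : inner x (- y) = - inner x y.
Proof. by rewrite innerC innerNl innerC. Qed.

Lemma inner0r x : inner x 0 = 0.
Proof. by rewrite innerC inner0l. Qed.

Definition innerE := (innerDl, innerDr, innerZl, innerZr, innerNl, innerNr,
  inner0l, inner0r).

Lemma inner_suml (I : Type) (r : seq I) (F : I -> l2 R) y :
  inner (\sum_(i <- r) F i) y = \sum_(i <- r) inner (F i) y.
Proof.
by elim/big_rec2: _ => [|i a b _ <-]; rewrite ?inner0l// innerDl.
Qed.

Lemma inner_sumr (I : Type) (r : seq I) (F : I -> l2 R) x :
  inner x (\sum_(i <- r) F i) = \sum_(i <- r) inner x (F i).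
Proof. by rewrite innerC inner_suml; apply: eq_bigr => i _; rewrite innerC. Qed.

Lemma sqr_l2_norm x : `|x| ^+ 2 = inner x x.
Proof. by rewrite l2_normE sqr_sqrtr// inner_ge0. Qed.

Lemma inner_inj x y : (inner x : l2 R -> R) = inner y -> x = y.
Proof.
move=> xy; apply/eqP; rewrite -subr_eq0; apply/eqP/inner_eq0.
by rewrite innerDl innerNl xy subrr.
Qed.

Lemma normr_inner_le x y : `|inner x y| <= `|x| * `|y|.
Proof.
rewrite -ler_sqr ?nnegrE ?mulr_ge0// exprMn !sqr_l2_norm real_normK ?num_real//.
exact: inner_CauchySchwarz.
Qed.

Lemma l2_coordD x y k : (x + y : l2 R) k = x k + y k. Proof. by []. Qed.
Lemma l2_coordZ a x k : (a *: x : l2 R) k = a * x k. Proof. by []. Qed.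
Lemma l2_coordN x k : (- x : l2 R) k = - x k. Proof. by []. Qed.
Lemma l2_coord0 k : (0 : l2 R) k = 0. Proof. by []. Qed.

Definition l2_coordE := (l2_coordD, l2_coordZ, l2_coordN, l2_coord0).

Lemma l2_coord_sum (I : Type) (r : seq I) (F : I -> l2 R) k :
  (\sum_(i <- r) F i : l2 R) k = \sum_(i <- r) F i k.
Proof. by elim/big_rec2: _ => [|i a b _ <-]. Qed.

Lemma l2_ext x y : x =1 y -> x = y.
Proof. by move=> xy; apply/val_inj/funext. Qed.

End InnerAlgebra.

Lemma bounded_linear_cont (R : realType) (V W : normedModType R)
    (f : {linear V -> W}) (C : R) :
  (forall x, `|f x| <= C * `|x|) -> continuous f.
Proof.
move=> fC; apply: bounded_linear_continuous; apply/linear_boundedP.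
near=> r => x; apply: (le_trans (fC x)).
by apply: ler_wpM2r => //; near: r; exact: nbhs_pinfty_ge.
Unshelve. all: by end_near. Qed.

Section InnerLinear.
Variables (R : realType) (g : l2 R).

(** The codomain is [R^o], the field as a normed module over itself, as in the
    definition of a gradient. *)
Definition innerf : l2 R -> R^o := inner g.

Fact innerf_linear : linear innerf.
Proof. by move=> a x y; rewrite /innerf innerDr innerZr. Qed.

HB.instance Definition _ := GRing.isLinear.Build R (l2 R) R^o _ innerf innerf_linear.

Lemma innerf_continuous : continuous innerf.
Proof. by apply: (@bounded_linear_cont _ _ _ _ `|g|) => x; exact: normr_inner_le. Qed.

End InnerLinear.

Section Gradients.
Variable R : realType.
Implicit Types (f : l2 R -> R) (x g : l2 R).

Lemma is_gradient_uniq f x g g' :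
  is_gradient f x g -> is_gradient f x g' -> g = g'.
Proof. by move=> [_ dg] [_ dg']; apply: inner_inj; rewrite -dg -dg'. Qed.

Lemma is_gradientP f x g C :
  (forall h, `|f (x + h) - (f x + inner g h)| <= C * `|h| ^+ 2) ->
  is_gradient f x g.
Proof.
move=> fC.
have E : (f : l2 R -> R^o) \o shift x = cst (f x : R^o) + innerf g +o_ (0 : l2 R) id.
  apply/eqaddoP => e e0; near=> h.
  apply: (@le_trans _ _ (C * `|h| ^+ 2)).
    have := fC h; rewrite [x + h]addrC; exact.
  rewrite expr2 mulrA ler_wpM2r//.
  apply: (@le_trans _ _ ((`|C| + 1) * `|h|)).
    by rewrite ler_wpM2r// (le_trans (ler_norm _))// lerDl.
  rewrite mulrC -ler_pdivlMr ?ltr_wpDl//.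
  near: h; apply/nbhs_norm0P; exists (e / (`|C| + 1)) => /=.
    by rewrite divr_gt0// ltr_wpDl.
  by move=> h /= /ltW.
have d := diff_unique (@innerf_continuous R g) E.
apply: DiffDef => //; apply/diff_locallyP; rewrite d; split => //.
exact: innerf_continuous.
Unshelve. all: by end_near. Qed.

End Gradients.

(** Costs and their conjugates are treated uniformly through Hessians [a + g Q],
    where [Q ^ 2 = 2 Q]: such operators are closed under inversion. *)
Section Quadratic.
Variables (R : realType) (Q : {linear l2 R -> l2 R}).
Hypothesis Q_sqr : forall x, Q (Q x) = 2 *: Q x.
Hypothesis Q_sym : forall x y, inner (Q x) y = inner x (Q y).
Implicit Types (x y b : l2 R) (a g c : R).

Let QD x y : Q (x + y) = Q x + Q y. Proof. exact: linearD. Qed.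
Let QB x y : Q (x - y) = Q x - Q y. Proof. exact: linearB. Qed.
Let QZ a x : Q (a *: x) = a *: Q x. Proof. exact: linearZ. Qed.

Definition quad a g b c x : R :=
  a / 2 * inner x x + g / 2 * inner (Q x) x + inner b x + c.

Definition quad_grad a g b x : l2 R := a *: x + g *: Q x + b.

Lemma quad_expand a g b c x h : quad a g b c (x + h) =
  quad a g b c x + inner (quad_grad a g b x) h +
  (a / 2 * inner h h + g / 2 * inner (Q h) h).
Proof.
rewrite /quad /quad_grad QD !innerE (innerC h x) (Q_sym h x) (innerC h (Q x)).
by field.
Qed.

Lemma quad_taylor a g b c x y : quad a g b c y =
  quad a g b c x + inner (quad_grad a g b x) (y - x) +
  (a / 2 * inner (y - x) (y - x) + g / 2 * inner (Q (y - x)) (y - x)).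
Proof. by rewrite -quad_expand [x + _]addrC subrK. Qed.

Lemma inner_Q_sqr x : inner (Q x) (Q x) = 2 * inner (Q x) x.
Proof. by rewrite Q_sym Q_sqr innerZr innerC. Qed.

Lemma inner_Q_ge0 x : 0 <= inner (Q x) x.
Proof. by have := inner_ge0 (Q x); rewrite inner_Q_sqr pmulr_rge0. Qed.

(** [Q / 2] is an orthogonal projection, hence so is [1 - Q / 2]. *)
Lemma inner_Q_le x : inner (Q x) x <= 2 * inner x x.
Proof.
have := inner_ge0 (2 *: x - Q x).
rewrite !innerE (innerC x (Q x)) inner_Q_sqr; lra.
Qed.

Lemma quad_gradient a g b c x : is_gradient (quad a g b c) x (quad_grad a g b x).
Proof.
apply: (@is_gradientP _ _ _ _ (`|a| + `|g|)) => h.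
rewrite quad_expand [X in `|X|]addrAC subrr add0r sqr_l2_norm.
rewrite (le_trans (ler_normD _ _))// mulrDl lerD//.
  rewrite normrM (ger0_norm (inner_ge0 h)) ler_wpM2r ?inner_ge0//.
  by rewrite normrM [`|2^-1|]ger0_norm// ler_piMr// invf_le1 ?ler1n.
rewrite normrM (ger0_norm (inner_Q_ge0 h)) normrM [`|2^-1|]ger0_norm//.
by rewrite -mulrA ler_wpM2l// ler_pdivrMl// inner_Q_le.
Qed.

Lemma quad_has_gradient a g b c : has_gradient (quad a g b c).
Proof. by move=> x; exists (quad_grad a g b x); exact: quad_gradient. Qed.

Lemma quad_gradientE a g b c x y :
  is_gradient (quad a g b c) x y -> y = quad_grad a g b x.
Proof. by move=> /is_gradient_uniq; apply; exact: quad_gradient. Qed.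

Lemma quad_strongly_convex a g b c : 0 <= g -> strongly_convex a (quad a g b c).
Proof.
move=> g0; split; first exact: quad_has_gradient.
move=> x y d /quad_gradientE ->; rewrite [leRHS](quad_taylor _ _ _ _ x).
rewrite sqr_l2_norm lerD2l lerDl.
by rewrite mulr_ge0 ?inner_Q_ge0// divr_ge0.
Qed.

Lemma quad_smooth a g b c : 0 <= g -> smooth (a + 2 * g) (quad a g b c).
Proof.
move=> g0; split; first exact: quad_has_gradient.
move=> x y d /quad_gradientE ->; rewrite [leLHS](quad_taylor _ _ _ _ x).
rewrite sqr_l2_norm lerD2l; have := inner_Q_le (y - x).
set u := inner _ _; set v := inner _ _ => uv.
have : 0 <= g * (2 * v - u) by rewrite mulr_ge0// subr_ge0.
lra.
Qed.

(** The inverse Hessian lies in the span of the identity and [Q], because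
    [Q ^ 2 = 2 Q]. *)
Lemma quad_gradK a g b y : a != 0 -> a + 2 * g != 0 ->
  quad_grad a g b (quad_grad a^-1 (- g / (a * (a + 2 * g))) 0 (y - b)) = y.
Proof.
move=> a0 ag0; rewrite /quad_grad addr0 -[RHS](subrK b); congr (_ + _).
move: (y - b) => z; rewrite QD !QZ Q_sqr.
apply: l2_ext => k; rewrite !l2_coordE.
by field; rewrite a0 ag0.
Qed.

(** The conjugate of a quadratic function with Hessian [a + g Q] is a
    quadratic function whose Hessian is the inverse of [a + g Q]. *)
Lemma fenchel_quad_gradient a g b c x y : 0 < a -> 0 <= g ->
  is_gradient (fenchel_conj (quad a g b c)) x y ->
  y = quad_grad a^-1 (- g / (a * (a + 2 * g))) 0 (x - b).
Proof.
move=> a0 g0; set g' := - g / _.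
have a0' : a != 0 by rewrite gt_eqF.
have ag0 : a + 2 * g != 0 by rewrite gt_eqF// ltr_wpDr// mulr_ge0.
pose inv z := quad_grad a^-1 g' 0 (z - b).
have invK z : quad_grad a g b (inv z) = z by exact: quad_gradK.
have conjE z : fenchel_conj (quad a g b c) z = inner z (inv z) - quad a g b c (inv z).
  pose S : set R := range (fun w => inner z w - quad a g b c w).
  rewrite -[fenchel_conj _ _]/(sup S).
  have Sin : S (inner z (inv z) - quad a g b c (inv z)) by exists (inv z).
  have Sub : ubound S (inner z (inv z) - quad a g b c (inv z)).
    move=> _ [w _ <-]; rewrite (quad_taylor _ _ _ _ (inv z)).
    rewrite invK innerDr innerNr.
    have h1 := inner_ge0 (w - inv z).
    have h2 := inner_Q_ge0 (w - inv z).
    have h3 : 0 <= a / 2 * inner (w - inv z) (w - inv z).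
      by rewrite mulr_ge0// divr_ge0// ltW.
    have h4 : 0 <= g / 2 * inner (Q (w - inv z)) (w - inv z).
      by rewrite mulr_ge0// divr_ge0.
    lra.
  apply/eqP; rewrite eq_le; apply/andP; split.
    by apply: ge_sup => //; exists (inner z (inv z) - quad a g b c (inv z)).
  apply: ub_le_sup => //.
  by exists (inner z (inv z) - quad a g b c (inv z)).
have -> : fenchel_conj (quad a g b c) =
    quad a^-1 g' (- quad_grad a^-1 g' 0 b) (2^-1 * inner b (quad_grad a^-1 g' 0 b) - c).
  apply/funext => z; rewrite conjE.
  have -> : quad a g b c (inv z) = 2^-1 * inner (quad_grad a g b (inv z)) (inv z)
      + 2^-1 * inner b (inv z) + c.
    by rewrite /quad /quad_grad !innerE; field.
  rewrite invK /inv /quad /quad_grad QB !innerE.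
  rewrite (Q_sym b z) (innerC b (Q z)) (innerC b z) (innerC z (Q z)).
  rewrite (innerC b (Q b)) (innerC z (Q b)) (Q_sym b z) (innerC b (Q z)).
  by field.
move=> /quad_gradientE ->; rewrite /quad_grad addr0 QB.
apply: l2_ext => k; rewrite !l2_coordE; ring.
Qed.

End Quadratic.

(** * Operators moving the coordinates of a sequence *)

Section Rearrangement.
Variable R : realType.

(* The indices hit by the first [N] terms are distinct and bounded. *)
Lemma sum_injective_le (g : nat -> R) (f : nat -> nat) N :
  (forall j, 0 <= g j) -> injective f ->
  exists N', \sum_(0 <= j < N) g (f j) <= \sum_(0 <= j < N') g j.
Proof.
move=> g0 fI; pose s := map f (iota 0 N).
exists (\max_(j < N) f j).+1; rewrite -(big_map f xpredT) /index_iota !subn0 -/s.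
rewrite (perm_big [seq j <- iota 0 (\max_(j < N) f j).+1 | j \in s]).
  rewrite big_filter big_mkcond ler_sum// => j _.
  by case: ifP.
apply: uniq_perm; rewrite ?filter_uniq ?map_inj_uniq ?iota_uniq//.
move=> j; rewrite mem_filter andb_idr // => /mapP[i].
rewrite !mem_iota !add0n /= => iN ->; rewrite ltnS.
by rewrite (@leq_bigmax 'I_N (fun i => f i) (Ordinal iN)).
Qed.

Lemma partial_sum_le_inner (x : l2 R) N :
  \sum_(0 <= j < N) x j * x j <= inner x x.
Proof.
apply: nondecreasing_cvgn_le (@is_cvg_inner R x x) _.
by apply/nondecreasing_seqP => n; rewrite /series /= big_nat_recr//= lerDl -expr2 sqr_ge0.
Qed.

Lemma nneg_series_cvg (u : nat -> R) C : (forall j, 0 <= u j) ->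
  (forall N, \sum_(0 <= j < N) u j <= C) -> cvgn (series u).
Proof.
move=> u0 uC; apply: nondecreasing_is_cvgn.
  by apply/nondecreasing_seqP => n; rewrite /series /= big_nat_recr//= lerDl.
by exists C => _ [N _ <-]; exact: uC.
Qed.

Lemma bounded_square_summable (u : nat -> R) C :
  (forall N, \sum_(0 <= j < N) u j ^+ 2 <= C) -> u \in @square_summable R.
Proof.
move=> uC; apply/square_summableP; apply: (@nneg_series_cvg _ C) => // j.
exact: sqr_ge0.
Qed.

End Rearrangement.

Section Pick.
Variables (R : realType) (w : pred nat) (f : nat -> nat).
Hypothesis fK : involutive f.
Implicit Types x y : l2 R.

Definition coord_pick_seq x : nat -> R := fun j => if w j then x (f j) else 0.

Lemma coord_pick_seq_le x N : \sum_(0 <= j < N) coord_pick_seq x j ^+ 2 <= inner x x.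
Proof.
have [N' le_N'] := @sum_injective_le R (fun j => x j * x j) f N
  (fun j => sqr_ge0 (x j)) (inv_inj fK).
apply: le_trans (partial_sum_le_inner x N'); apply: le_trans le_N'.
apply: ler_sum => j _; rewrite /coord_pick_seq; case: ifP => // _.
by rewrite expr0n /= -expr2 sqr_ge0.
Qed.

(** Restricting [f] to involutions makes every pick a contraction whose adjoint is
    again a pick. *)
Definition coord_pick x : l2 R := L2 (bounded_square_summable (coord_pick_seq_le x)).

Lemma coord_pickE x j : coord_pick x j = if w j then x (f j) else 0.
Proof. by []. Qed.

Fact coord_pick_linear : linear coord_pick.
Proof.
move=> a x y; apply: l2_ext => j; rewrite !l2_coordE !coord_pickE.
by case: ifP => // _; rewrite ?l2_coordE// mulr0 addr0.
Qed.

HB.instance Definition _ :=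
  GRing.isLinear.Build R (l2 R) (l2 R) _ coord_pick coord_pick_linear.

Lemma inner_pick_le x : inner (coord_pick x) (coord_pick x) <= inner x x.
Proof.
apply: limr_le; first exact: is_cvg_inner.
by apply: nearW => N; exact: coord_pick_seq_le.
Qed.

Lemma norm_pick_le x : `|coord_pick x| <= `|x|.
Proof. by rewrite !l2_normE ler_wsqrtr// inner_pick_le. Qed.

End Pick.

Lemma inner_eq_mul (R : realType) (x y x' y' : l2 R) :
  (forall j, x j * y j = x' j * y' j) -> inner x y = inner x' y'.
Proof. by move=> E; rewrite /inner; congr (limn (series _)); apply/funext. Qed.

(** An involution applied twice is the identity, so the contraction it induces is
    an isometry; polarization passes from norms to inner products. *)
Lemma inner_perm (R : realType) (f : nat -> nat) (fK : involutive f) (x y : l2 R) :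
  inner (coord_pick predT fK x) (coord_pick predT fK y) = inner x y.
Proof.
pose p : {linear l2 R -> l2 R} := coord_pick predT fK.
have pp z : inner (p z) (p z) = inner z z.
  apply/eqP; rewrite eq_le inner_pick_le.
  have zE : coord_pick predT fK (p z) = z by apply: l2_ext => j; rewrite !coord_pickE fK.
  by have := inner_pick_le predT fK (p z); rewrite zE.
have := pp (x + y); rewrite linearD !innerE !pp (innerC y x) (innerC (p y)).
by rewrite /p /=; lra.
Qed.

Lemma inner_pickl (R : realType) (w : pred nat) (f : nat -> nat)
    (fK : involutive f) (x y : l2 R) :
  inner (coord_pick w fK x) y = inner x (coord_pick (fun j => w (f j)) fK y).
Proof.
have idK : involutive (@id nat) by [].
have -> : inner (coord_pick w fK x) y = inner (coord_pick predT fK x) (coord_pick w idK y).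
  by apply: inner_eq_mul => j; rewrite !coord_pickE; case: ifP; rewrite ?mul0r ?mulr0.
rewrite -(inner_perm fK x); apply: inner_eq_mul => j.
by rewrite !coord_pickE /= fK.
Qed.

(** * Block-diagonal operators *)

(** The index [k * d.+1 + p] stands for the index [k] of the chain in block [p]. *)
Section Cells.
Variable d : nat.

Lemma cell_div k (p : 'I_d.+1) : ((k * d.+1 + p) %/ d.+1 = k)%N.
Proof. by rewrite divnMDl// divn_small ?addn0. Qed.

Lemma cell_mod k (p : 'I_d.+1) : ((k * d.+1 + p) %% d.+1 = p)%N.
Proof. by rewrite modnMDl modn_small. Qed.

Lemma cellP j : exists k (p : 'I_d.+1), j = (k * d.+1 + p)%N.
Proof.
by exists (j %/ d.+1)%N, (Ordinal (ltn_pmod j (ltn0Sn d))) => /=; exact: divn_eq.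
Qed.

Lemma cell_ext (R : realType) (x y : l2 R) :
  (forall k (p : 'I_d.+1), x (k * d.+1 + p)%N = y (k * d.+1 + p)%N) -> x = y.
Proof. by move=> xy; apply: l2_ext => j; have [k [p ->]] := cellP j. Qed.

Definition cell_swap (p q : 'I_d.+1) j :=
  (j %/ d.+1 * d.+1 + (if j %% d.+1 == p then val q else
    if j %% d.+1 == q then val p else j %% d.+1))%N.

Lemma cell_swapE p q k (r : 'I_d.+1) :
  cell_swap p q (k * d.+1 + r) =
  (k * d.+1 + (if r == p then q else if r == q then p else r))%N.
Proof.
rewrite /cell_swap cell_div cell_mod; congr (_ + _)%N.
by do 2 (rewrite -val_eqE /=; case: ifP => // _).
Qed.

Lemma cell_swapK p q : involutive (cell_swap p q).
Proof.
move=> j; have [k [r ->]] := cellP j; rewrite !cell_swapE; congr (_ + val _)%N.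
have [->|rp] := eqVneq r p; first by case: (eqVneq q p) => [->|]; rewrite ?eqxx.
have [->|rq] := eqVneq r q; first by rewrite eqxx.
by rewrite (negPf rp) (negPf rq).
Qed.

Variable R : realType.
Implicit Types (M N : 'M[R]_d.+1) (x y : l2 R) (p q : 'I_d.+1).

Definition unit_op (p q : 'I_d.+1) : l2 R -> l2 R :=
  coord_pick (fun j => j %% d.+1 == p)%N (cell_swapK p q).

Lemma unit_opE p q x k (r : 'I_d.+1) :
  unit_op p q x (k * d.+1 + r)%N = (r == p)%:R * x (k * d.+1 + q)%N.
Proof.
rewrite coord_pickE cell_mod cell_swapE val_eqE; case: eqP => _; rewrite ?mul1r//.
by rewrite mul0r.
Qed.

Lemma inner_unit_op p q x y : inner (unit_op p q x) y = inner x (unit_op q p y).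
Proof.
rewrite inner_pickl; congr inner; apply: cell_ext => k r.
rewrite unit_opE coord_pickE cell_swapE cell_mod val_eqE.
have [rp|rp] := eqVneq r p.
  by rewrite rp [p == q]eq_sym; case: eqP => [->|]; rewrite ?mul1r ?mul0r.
have [rq|rq] := eqVneq r q; first by rewrite eqxx mul1r.
by rewrite (negPf rp) mul0r.
Qed.

(** Written as a finite combination of coordinate picks, so that linearity,
    continuity and the adjoint are inherited from those. *)
Definition block_op M x : l2 R := \sum_p \sum_q M p q *: unit_op p q x.

Lemma block_opE M x k (p : 'I_d.+1) :
  block_op M x (k * d.+1 + p)%N = \sum_q M p q * x (k * d.+1 + q)%N.
Proof.
rewrite l2_coord_sum (bigD1 p)//= [X in _ + X]big1 ?addr0 => [|i ip].
  rewrite l2_coord_sum; apply: eq_bigr => q _.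
  by rewrite l2_coordZ unit_opE eqxx mul1r.
rewrite l2_coord_sum big1// => q _.
by rewrite l2_coordE unit_opE eq_sym (negPf ip) mul0r mulr0.
Qed.

Fact block_op_linear M : linear (block_op M).
Proof.
move=> a x y; apply: cell_ext => k p; rewrite !(l2_coordE, block_opE).
rewrite mulr_sumr -big_split; apply: eq_bigr => q _ /=.
transitivity (M p q * (a * x (k * d.+1 + q)%N + y (k * d.+1 + q)%N)) => //.
by ring.
Qed.

HB.instance Definition _ M :=
  GRing.isLinear.Build R (l2 R) (l2 R) _ (block_op M) (block_op_linear M).

Lemma block_op_continuous M : continuous (block_op M).
Proof.
apply: (@bounded_linear_cont _ _ _ _ (\sum_p \sum_q `|M p q|)) => x.
rewrite mulr_suml (le_trans (ler_norm_sum _ _ _))// ler_sum// => p _.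
rewrite mulr_suml (le_trans (ler_norm_sum _ _ _))// ler_sum// => q _.
by rewrite normrZ ler_wpM2l// norm_pick_le.
Qed.

Lemma inner_block_op M x y : inner (block_op M x) y = inner x (block_op M^T y).
Proof.
rewrite inner_suml inner_sumr; under eq_bigr do rewrite inner_suml.
under [RHS]eq_bigr do rewrite inner_sumr.
rewrite exchange_big; apply: eq_bigr => p _; apply: eq_bigr => q _.
by rewrite innerZl innerZr inner_unit_op mxE.
Qed.

Lemma block_op_mul M N x : block_op (M *m N) x = block_op M (block_op N x).
Proof.
apply: cell_ext => k p; rewrite !block_opE.
under eq_bigr do rewrite mxE mulr_suml.
rewrite exchange_big; apply: eq_bigr => r _; rewrite block_opE mulr_sumr.
by apply: eq_bigr => q _; rewrite mulrA.
Qed.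

Lemma block_op_scalar a x : block_op a%:M x = a *: x.
Proof.
apply: cell_ext => k p; rewrite block_opE (bigD1 p)//= big1 ?addr0.
  by rewrite mxE eqxx.
by move=> q qp; rewrite mxE eq_sym (negPf qp) mul0r.
Qed.

Lemma block_opB M N x : block_op (M - N) x = block_op M x - block_op N x.
Proof.
apply: cell_ext => k p; rewrite !(l2_coordE, block_opE) -sumrB.
by apply: eq_bigr => q _; rewrite !mxE mulrBl.
Qed.

End Cells.

Section Geometric.
Variables (R : realType) (d : nat).

Lemma sum_cells (F : nat -> R) N : \sum_(0 <= j < N * d.+1) F j =
  \sum_(0 <= k < N) \sum_(p < d.+1) F (k * d.+1 + p)%N.
Proof.
elim: N => [|N IH]; first by rewrite mul0n !big_geq.
rewrite [RHS]big_nat_recr//= -IH mulSn addnC (@big_cat_nat _ _ _ (N * d.+1)) ?leq_addr//=.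
congr (_ + _); rewrite -{1}[(N * d.+1)%N]add0n big_addn addKn big_mkord.
by apply: eq_bigr => p _; rewrite addnC.
Qed.

Lemma sum_geometric_le (r : R) N : 0 <= r < 1 ->
  \sum_(0 <= k < N) r ^+ k <= (1 - r)^-1.
Proof.
move=> /andP[r0 r1]; rewrite -[leRHS]mul1r ler_pdivlMr ?subr_gt0//.
suff -> : (\sum_(0 <= k < N) r ^+ k) * (1 - r) = 1 - r ^+ N.
  by rewrite lerBlDr lerDl exprn_ge0.
elim: N => [|N IH]; first by rewrite big_geq// mul0r expr0 subrr.
by rewrite big_nat_recr//= mulrDl IH exprS; ring.
Qed.

Variables (r : R) (P : pred nat).
Hypothesis r01 : 0 <= r < 1.

Definition geo_seq j : R := r ^+ (j %/ d.+1) * (P (j %% d.+1)%N)%:R.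

Fact geo_subproof N : \sum_(0 <= j < N) geo_seq j ^+ 2 <= d.+1%:R * (1 - r)^-1.
Proof.
have /andP[r0 r1] := r01.
apply: (@le_trans _ _ (\sum_(0 <= j < N * d.+1) geo_seq j ^+ 2)).
  rewrite [leRHS](@big_cat_nat _ _ _ N) ?leq_pmulr//= lerDl sumr_ge0// => j _.
  exact: sqr_ge0.
rewrite sum_cells; apply: le_trans (ler_wpM2l _ (sum_geometric_le N r01)) => //.
rewrite mulr_sumr ler_sum// => k _.
rewrite mulr_natl (_ : _ *+ _ = \sum_(p < d.+1) r ^+ k); last first.
  by rewrite sumr_const card_ord.
rewrite ler_sum// => p _.
rewrite /geo_seq cell_div cell_mod; set s := r ^+ k.
have s0 : 0 <= s by exact: exprn_ge0.
have s1 : s <= 1 by rewrite exprn_ile1// ltW.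
case: (P _); rewrite ?mulr1 ?mulr0 ?expr0n//=.
by rewrite expr2 ler_piMl.
Qed.

(** The ratio [r = 0] is allowed; since [0 ^+ 0 = 1], it gives the indicator of the
    blocks of [P] at index [0] of the chain. *)
Definition geo : l2 R := L2 (bounded_square_summable geo_subproof).
Arguments geo : simpl never.

Lemma geoE k (p : 'I_d.+1) : geo (k * d.+1 + p)%N = r ^+ k * (P p)%:R.
Proof. by rewrite -[LHS]/(geo_seq _) /geo_seq cell_div cell_mod. Qed.

End Geometric.
Arguments geo : simpl never.

(** * Spectra of block-diagonal operators *)

Section BlockSpectrum.
Variables (R : realType) (d n : nat) (M : 'M[R]_d.+1).

Definition block_map (x : 'I_n -> l2 R) : 'I_n -> l2 R := fun i => block_op M (x i).

(** When [l] is not an eigenvalue, the inverse of [M - l] acts on all blocks and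
    inverts the operator: infinite dimension adds nothing to the spectrum. *)
Lemma block_spectrum l : op_spectrum block_map l -> eigenvalue M l.
Proof.
move=> nbij; apply: contrapT => nl; apply: nbij.
have U : M - l%:M \in unitmx.
  apply: contrapT => nU; apply: nl; rewrite /eigenvalue /eigenspace.
  by rewrite kermx_eq0 row_free_unit; apply/negP.
have E x : (fun v => block_map v - l *: v) x = (fun i => block_op (M - l%:M) (x i)).
  by apply/funext => i /=; rewrite block_opB block_op_scalar.
exists (fun x i => block_op (invmx (M - l%:M)) (x i)) => x; apply/funext => i.
  by rewrite E -block_op_mul mulVmx// block_op_scalar scale1r.
by rewrite E -block_op_mul mulmxV// block_op_scalar scale1r.
Qed.

Lemma block_eigenvalue (i0 : 'I_n) l (p : 'I_d.+1) :
  (forall q, M q p = l *+ (q == p)) -> op_eigenvalue block_map l.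
Proof.
move=> Mp; have r01 : (0 : R) <= (0 : R) < (1 : R) by rewrite lexx ltr01.
exists (fun=> geo d (pred1 (val p)) r01).
  apply/eqP => /(congr1 (fun x : 'I_n -> l2 R => x i0 (0 * d.+1 + p)%N)).
  by rewrite geoE /= eqxx mulr1 expr0; apply/eqP/oner_neq0.
apply/funext => i; apply: (@cell_ext d) => k q.
rewrite block_opE (bigD1 p)// big1 ?addr0 => [|q' /andP[_ q'p]]; last first.
  by rewrite geoE /= val_eqE (negPf q'p) !mulr0.
rewrite geoE Mp /= eqxx mulr1 -[RHS]/(l * geo d (pred1 (val p)) r01 _) geoE /=.
by rewrite val_eqE addr0; case: eqP => _; rewrite ?mulr1n ?mulr0n ?mulr1 ?mulr0 ?mul0r.
Qed.

Lemma eigenvalue_spectrum l : op_eigenvalue block_map l -> op_spectrum block_map l.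
Proof.
move=> [v v0 Tv] /bij_inj inj; move/eqP: v0; apply; apply: inj.
rewrite Tv subrr; apply/funext => i.
by rewrite -[RHS]/(block_op M 0 - l *: 0) linear0 scaler0 subrr.
Qed.

End BlockSpectrum.

(** * The path constraint *)

Section PathEigen.
Variables (R : realType) (m : nat) (y : nat -> R) (l : R).
Hypothesis path_eq : forall q, (q < m)%N ->
  (if (q.+1 < m)%N then y q - y q.+1 else 0) -
  (if (0 < q)%N then y q.-1 - y q else 0) = l * y q.

Lemma path_sum q : (q < m)%N ->
  (if (q.+1 < m)%N then y q - y q.+1 else 0) = l * \sum_(0 <= j < q.+1) y j.
Proof.
elim: q => [|q IH] qm.
  by rewrite big_nat1 -path_eq//= subr0.
rewrite big_nat_recr//= mulrDr -IH ?(ltnW qm)// -(path_eq qm)/= qm.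
by rewrite [RHS]addrC subrK.
Qed.

Lemma path_dist D : (forall j, (j.+1 < m)%N -> `|y j - y j.+1| <= D) ->
  0 <= D -> forall p q, (p < m)%N -> (q < m)%N -> `|y p - y q| <= m%:R * D.
Proof.
move=> yD D0.
have le p k : (p + k < m)%N -> `|y p - y (p + k)%N| <= k%:R * D.
  elim: k => [|k IH]; first by rewrite addn0 subrr normr0 mul0r.
  rewrite addnS => pk; rewrite -natr1 mulrDl mul1r.
  rewrite -[y p - _](subrKA (y (p + k)%N)) (le_trans (ler_normD _ _))//.
  by rewrite lerD ?yD// IH// ltnW.
have {}le p q : (p <= q < m)%N -> `|y p - y q| <= m%:R * D.
  move=> /andP[pq qm]; rewrite -{1}(subnKC pq).
  apply: le_trans (le _ _ _) _; first by rewrite subnKC.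
  by rewrite ler_wpM2r// ler_nat (leq_trans (leq_subr _ _))// ltnW.
move=> p q pm qm; case/orP: (leq_total p q) => pq; first by rewrite le// pq.
by rewrite distrC le// pq.
Qed.

Lemma exists_max_norm p : (p < m)%N ->
  exists2 p0, (p0 < m)%N & forall q, (q < m)%N -> `|y q| <= `|y p0|.
Proof.
move=> pm; case: (@arg_maxP _ R 'I_m (Ordinal pm) xpredT (fun i => `|y i|)) => //.
by move=> p0 _ max; exists p0 => // q qm; exact: (max (Ordinal qm)).
Qed.

(** Summing the eigenvector equations expresses each difference of neighbours
    through the entries, and shows that the entries sum to zero. So the entry of
    largest modulus is joined to an entry of opposite sign by at most [m] steps,
    each of size at most [l * m] times that modulus. *)
Lemma path_eigen_bounds p : (p < m)%N -> y p != 0 -> 0 < l ->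
  m%:R ^- 2 <= l <= 4.
Proof.
move=> pm yp l0; have [p0 p0m max] := exists_max_norm pm.
have V0 : 0 < `|y p0| by rewrite (lt_le_trans _ (max p pm))// normr_gt0.
have mp : (0 < m)%N by rewrite (leq_ltn_trans _ pm).
have m0 : 0 < m%:R :> R by rewrite ltr0n.
apply/andP; split; last first.
  have := congr1 Num.norm (path_eq p0m); rewrite normrM (gtr0_norm l0) => E.
  rewrite -(ler_pM2r V0) -E (le_trans (ler_normB _ _))//.
  have -> : 4 * `|y p0| = (`|y p0| + `|y p0|) + (`|y p0| + `|y p0|) by ring.
  rewrite lerD//.
    case: ifP => [h|_]; last by rewrite normr0 addr_ge0.
    by rewrite (le_trans (ler_normB _ _))// lerD// max.
  case: ifP => [h|_]; last by rewrite normr0 addr_ge0.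
  rewrite (le_trans (ler_normB _ _))// lerD// max//.
  by rewrite (leq_ltn_trans (leq_pred _)).
have S0 : \sum_(0 <= j < m) y j = 0.
  have m1m : (m.-1 < m)%N by rewrite prednK.
  have := path_sum m1m; rewrite prednK// ltnn.
  by move/esym/eqP; rewrite mulf_eq0 gt_eqF//= => /eqP.
have [q qm qp] : exists2 q, (q < m)%N & y q * y p0 <= 0.
  apply: contrapT => no.
  have : 0 < \sum_(i < m) y i * y p0.
    rewrite (bigD1 (Ordinal p0m))//= ltr_wpDr//.
      rewrite sumr_ge0// => i _; rewrite leNgt; apply/negP => h; apply: no.
      by exists i => //; exact: ltW.
    by rewrite -expr2 exprn_even_gt0//= -normr_gt0.
  by rewrite -mulr_suml -(big_mkord xpredT) S0 mul0r ltxx.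
have diff j : (j.+1 < m)%N -> `|y j - y j.+1| <= l * (m%:R * `|y p0|).
  move=> jm; have := path_sum (ltnW jm); rewrite jm => ->.
  rewrite normrM (gtr0_norm l0) ler_wpM2l ?(ltW l0)//.
  rewrite (le_trans (ler_norm_sum _ _ _))// big_nat.
  rewrite (le_trans (ler_sum _ (G := fun=> `|y p0|) _))//.
    by move=> i /andP[_ ij]; rewrite max// (leq_trans ij)// ltnW.
  rewrite -big_nat sumr_const_nat subn0 -[leLHS]mulr_natl ler_wpM2r// ler_nat.
  exact: ltnW.
have := path_dist diff _ p0m qm; rewrite !mulr_ge0 ?(ltW l0)// => /(_ isT) le1.
have le2 : `|y p0| <= `|y p0 - y q|.
  rewrite -ler_sqr ?nnegrE// !real_normK ?num_real// sqrrB.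
  have := sqr_ge0 (y q); rewrite mulrC in qp; lra.
have := le_trans le2 le1.
have -> : m%:R * (l * (m%:R * `|y p0|)) = (l * m%:R ^+ 2) * `|y p0| by ring.
by rewrite ler_pMl// -ler_pdivrMr ?exprn_gt0// mul1r.
Qed.

End PathEigen.

Section PathMatrix.
Variables (R : realType) (m : nat) (sa su : R).

(** The first [m] blocks form a path, on which the constraint is consensus. Two
    further blocks carry prescribed eigenvalues [sa ^ 2] and [su ^ 2] of the Gram
    matrix: bracketing the spectrum of the path, they set its condition number
    exactly without computing that spectrum. *)
Definition path_mx : 'M[R]_m.+2 := \matrix_(p, q)
  if (p.+1 < m)%N then (q == p)%:R - (q == p.+1 :> nat)%:R
  else if (p < m)%N then 0
  else (q == p)%:R * (if p == m :> nat then sa else su).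

Definition path_gram : 'M[R]_m.+2 := path_mx^T *m path_mx.

Lemma path_mx_neq0 p q : path_mx p q != 0 -> (q == p) || (q == p.+1 :> nat).
Proof.
rewrite mxE; case: ifP => _.
  case: (q == p) => //=; case: (_ == _ :> nat) => //; by rewrite subrr eqxx.
case: ifP => _; first by rewrite eqxx.
by case: (q == p) => //=; rewrite mul0r eqxx.
Qed.

Lemma path_gram_neq0 p q : path_gram p q != 0 -> (p <= q.+1)%N && (q <= p.+1)%N.
Proof.
rewrite mxE; apply: contraNT => pq; rewrite big1// => s _; rewrite mxE.
apply/eqP; rewrite mulf_eq0; apply: contraNT pq.
rewrite negb_or => /andP[/path_mx_neq0 + /path_mx_neq0].
rewrite -!val_eqE /=; lia.
Qed.

Lemma path_mx_mul (x : nat -> R) (p : 'I_m.+2) :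
  \sum_q path_mx p q * x q =
  if (p.+1 < m)%N then x p - x p.+1
  else if (p < m)%N then 0 else (if p == m :> nat then sa else su) * x p.
Proof.
have sum1 (q0 : 'I_m.+2) : \sum_q (q == q0)%:R * x q = x q0.
  rewrite (bigD1 q0)//= big1 ?addr0 ?eqxx ?mul1r// => q qq.
  by rewrite (negPf qq) mul0r.
case: ifP => pm; under eq_bigr do rewrite mxE pm.
  have p1 : (p.+1 < m.+2)%N by lia.
  under eq_bigr do rewrite mulrBl.
  rewrite sumrB sum1; congr (_ - _); rewrite -(sum1 (Ordinal p1)).
  by apply: eq_bigr => q _.
case: (ltnP p m) => pm'; first by rewrite big1// => q _; rewrite mul0r.
case: ifP => pm''; under eq_bigr do rewrite [_%:R * _]mulrC -mulrA.
  by rewrite -mulr_sumr sum1.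
by rewrite -mulr_sumr sum1.
Qed.

Lemma path_mxT_mul (w : nat -> R) (q : 'I_m.+2) :
  \sum_p path_mx p q * w p =
  if (q < m)%N then (if (q.+1 < m)%N then w q else 0) -
    (if (0 < q)%N then w q.-1 else 0)
  else (if q == m :> nat then sa else su) * w q.
Proof.
rewrite (bigD1 q)//=.
have [qm|mq] := ltnP q m; last first.
  rewrite big1 ?addr0 => [|p pq].
    by rewrite mxE ltnNge leqW//= ltnNge mq/= eqxx mul1r.
  rewrite mxE; case: ifP => [pm|_].
    by rewrite eq_sym (negPf pq) (_ : _ == _ = false) ?subrr ?mul0r//; lia.
  by case: ifP => _; rewrite ?mul0r// eq_sym (negPf pq) !mul0r.
congr (_ + _).
  rewrite mxE qm eqxx (_ : (q == q.+1 :> nat) = false); last by lia.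
  by rewrite subr0; case: ifP; rewrite ?mul1r ?mul0r.
case: ifP => q0; last first.
  rewrite big1 ?oppr0// => p pq; have : path_mx p q == 0.
    by apply/negPn/negP => /path_mx_neq0; move: pq; rewrite -!val_eqE /=; lia.
  by move=> /eqP ->; rewrite mul0r.
have q1 : (q.-1 < m.+2)%N by lia.
rewrite (bigD1 (Ordinal q1)) /=; last by rewrite -val_eqE /=; lia.
rewrite big1 ?addr0 => [|p /andP[pq pq1]].
  rewrite mxE /= prednK// qm eqxx -val_eqE /= (_ : (q == q.-1 :> nat) = false).
    by rewrite sub0r mulN1r.
  by lia.
have : path_mx p q == 0.
  apply/negPn/negP => /path_mx_neq0.
  by move: pq pq1; rewrite -!val_eqE /=; lia.
by move=> /eqP ->; rewrite mul0r.
Qed.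

Lemma path_gram_mul (x : nat -> R) (q : 'I_m.+2) :
  \sum_p path_gram q p * x p =
  if (q < m)%N then (if (q.+1 < m)%N then x q - x q.+1 else 0) -
    (if (0 < q)%N then x q.-1 - x q else 0)
  else (if q == m :> nat then sa ^+ 2 else su ^+ 2) * x q.
Proof.
pose w (p : nat) := if (p.+1 < m)%N then x p - x p.+1
  else if (p < m)%N then 0 else (if p == m then sa else su) * x p.
transitivity (\sum_p path_mx p q * w p).
  have wE (p : 'I_m.+2) : w p = \sum_s path_mx p s * x s by rewrite path_mx_mul.
  under [RHS]eq_bigr => p _ do rewrite wE mulr_sumr.
  rewrite exchange_big; apply: eq_bigr => p _; rewrite mxE mulr_suml.
  by apply: eq_bigr => s _; rewrite mxE mulrA.
rewrite path_mxT_mul /w; case: ifP => qm.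
  congr (_ - _); first by case: (q.+1 < m)%N.
  case: ifP => // q0; by rewrite prednK// qm.
have -> : (q.+1 < m)%N = false by lia.
by case: ifP => _; rewrite qm mulrA expr2.
Qed.

Lemma path_gram_sym : path_gram^T = path_gram.
Proof. by rewrite /path_gram trmx_mul trmxK. Qed.

Lemma path_gram_extra (p q : 'I_m.+2) : (m <= p)%N ->
  path_gram q p = (if p == m :> nat then sa ^+ 2 else su ^+ 2) *+ (q == p).
Proof.
move=> mp; have := path_gram_mul (fun j => (j == p)%:R) q.
rewrite (bigD1 p)//= eqxx mulr1 big1 ?addr0 => [->|s sp]; last first.
  by rewrite val_eqE (negPf sp) mulr0.
rewrite val_eqE; have [->|qp] := eqVneq q p.
  by rewrite ltnNge mp/= mulr1.
rewrite mulr0; case: ifP => // qm.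
have E r : (r < m)%N -> (r == p)%:R = 0 :> R.
  by move=> rm; rewrite (_ : (r == p) = false)//; lia.
rewrite (E q.-1); last by lia.
by case: ifP => q1; case: ifP => q0; rewrite ?E ?subr0.
Qed.

Lemma path_gram_eigenvalue l : eigenvalue path_gram l -> 0 < l ->
  [\/ l = sa ^+ 2, l = su ^+ 2 |
      m%:R ^- 2 <= l <= 4 /\ (m = 2%N -> l = 2)].
Proof.
move=> /eigenvalueP[v vl v0] l0; pose y j := v ord0 (inord j).
have eqv (q : 'I_m.+2) : \sum_p path_gram q p * y p = l * y q.
  have := congr1 (fun u : 'rV_m.+2 => u ord0 q) vl; rewrite mxE [RHS]mxE.
  rewrite /y inord_val => <-; apply: eq_bigr => p _.
  by rewrite inord_val mulrC -{1}path_gram_sym mxE.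
have ext (q : 'I_m.+2) : (m <= q)%N -> y q != 0 ->
    l = if q == m :> nat then sa ^+ 2 else su ^+ 2.
  move=> mq yq; have := eqv q; rewrite path_gram_mul ltnNge mq/=.
  by move/(mulIf yq) => ->.
have [p yp] : exists p : 'I_m.+2, y p != 0.
  apply: contrapT => no; move/eqP: v0; apply; apply/rowP => p; rewrite mxE.
  apply/eqP/negPn/negP => vp; apply: no; exists p.
  by rewrite /y inord_val.
have [pm|mp] := ltnP p m; last first.
  by have := ext p mp yp; case: ifP => _ ->; [exact: Or31 | exact: Or32].
have path_eq q : (q < m)%N ->
    (if (q.+1 < m)%N then y q - y q.+1 else 0) -
    (if (0 < q)%N then y q.-1 - y q else 0) = l * y q.
  move=> qm; have qm2 : (q < m.+2)%N by lia.
  by have := eqv (Ordinal qm2); rewrite path_gram_mul /= qm.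
apply: Or33; split; first exact: path_eigen_bounds path_eq _ pm yp l0.
move=> m2; have e0 := path_eq 0%N; have e1 := path_eq 1%N.
rewrite m2 /= in e0 e1; have {}e0 := e0 isT; have {}e1 := e1 isT.
have ys : l * (y 0%N + y 1%N) = 0 by rewrite mulrDr -e0 -e1; ring.
have y1 : y 1%N = - y 0%N.
  by apply/eqP; rewrite -addr_eq0 addrC; move/eqP: ys; rewrite mulf_eq0 gt_eqF.
have y0 : y 0%N != 0.
  move: yp; have [-> //|->] : nat_of_ord p = 0%N \/ nat_of_ord p = 1%N by lia.
  by rewrite y1 oppr_eq0.
by apply: (mulIf y0); rewrite -e0 y1; ring.
Qed.

End PathMatrix.

(** * Gossip matrices of stars *)

Section Star.
Variables (R : realType) (n : nat) (w : R) (c : 'I_n).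
Hypothesis w_gt0 : 0 < w.

Definition star : rel 'I_n := fun i j => (i != j) && ((i == c) || (j == c)).

Definition star_mx : 'M[R]_n := \matrix_(i, j)
  (w * (if i == j then if i == c then n%:R - 1 else 1
        else if (i == c) || (j == c) then -1 else 0)).

Lemma star_undirected : undirected_graph star.
Proof.
split=> [i j|i]; first by rewrite /star eq_sym orbC.
by rewrite /star eqxx.
Qed.

Lemma star_mx_sym : star_mx^T = star_mx.
Proof.
apply/matrixP => i j; rewrite !mxE eq_sym orbC; congr (_ * _).
by case: eqP => [->|].
Qed.

Lemma star_mx_mul (v : 'I_n -> R) i : \sum_j star_mx i j * v j =
  w * (if i == c then n%:R * v c - \sum_j v j else v i - v c).
Proof.
under eq_bigr do rewrite mxE -mulrA.
rewrite -mulr_sumr; congr (_ * _); case: (eqVneq i c) => [->|ic].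
  rewrite (bigD1 c)//= eqxx [in RHS](bigD1 c)//=.
  rewrite (eq_bigr (fun j => - v j)) => [|j jc]; first by rewrite sumrN; ring.
  by rewrite eq_sym (negPf jc) mulN1r.
rewrite (bigD1 i)//= eqxx mul1r; congr (_ + _).
rewrite (bigD1 c) /=; last by rewrite eq_sym.
rewrite big1 => [|j /andP[ji jc]].
  by rewrite (negPf ic) eqxx mulN1r addr0.
by rewrite eq_sym (negPf ji) (negPf jc) mul0r.
Qed.

Lemma star_form (v : 'I_n -> R) :
  \sum_i v i * (\sum_j star_mx i j * v j) = w * \sum_i (v i - v c) ^+ 2.
Proof.
under eq_bigr do rewrite star_mx_mul mulrCA.
rewrite -mulr_sumr; congr (_ * _); set S := \sum_j v j.
rewrite (bigD1 c)//= eqxx [in RHS](bigD1 c)//= subrr expr0n /= add0r.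
rewrite (eq_bigr (fun i => v i * (v i - v c))) => [|i ic]; last by rewrite (negPf ic).
have -> : n%:R * v c = \sum_(j < n) v c by rewrite sumr_const card_ord mulr_natl.
rewrite /S -sumrB (bigD1 c)//= subrr add0r mulr_sumr -big_split /=.
by apply: eq_bigr => i _; ring.
Qed.

Lemma star_gossip : (1 < n)%N -> gossip_matrix star star_mx.
Proof.
move=> n1; split; first split; first exact: star_mx_sym.
- move=> v; rewrite -mulmxA mxE; under eq_bigr do rewrite !mxE.
  rewrite (star_form (fun i => v i ord0)) mulr_ge0 ?(ltW w_gt0)// sumr_ge0// => i _.
  exact: sqr_ge0.
- move=> i j; rewrite mxE mulf_eq0 (gt_eqF w_gt0)/= /star.
  have [_|_] := eqVneq i j; rewrite ?orbT ?orbF/=.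
    case: ifP => _; rewrite ?oner_eq0// subr_eq0 -[1]/(1%:R) eqr_nat; lia.
  by case: ifP => _; rewrite ?oppr_eq0 ?oner_eq0 ?eqxx.
- move=> v; split=> [Wv i j|vE].
    suff vc k : v k ord0 = v c ord0 by rewrite !vc.
    have [->//|kc] := eqVneq k c.
    have := congr1 (fun u : 'cV_n => u k ord0) Wv; rewrite !mxE.
    rewrite (star_mx_mul (fun i => v i ord0)) (negPf kc) => /eqP.
    by rewrite mulf_eq0 (gt_eqF w_gt0)/= subr_eq0 => /eqP.
  apply/colP => i; rewrite !mxE (star_mx_mul (fun i => v i ord0)).
  case: ifP => _; last by rewrite (vE i c) subrr mulr0.
  rewrite (eq_bigr (fun=> v c ord0)) => [|j _]; last exact: vE.
  by rewrite sumr_const card_ord -[v c ord0 *+ n]mulr_natl subrr mulr0.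
Qed.

Lemma star_eigenvalueP l : eigenvalue star_mx l <->
  exists2 v : 'I_n -> R, (forall i, \sum_j star_mx i j * v j = l * v i) &
    exists i, v i != 0.
Proof.
split.
  move=> /eigenvalueP[v vl v0]; exists (v ord0) => [i|].
    have := congr1 (fun u : 'rV_n => u ord0 i) vl; rewrite mxE [RHS]mxE => <-.
    by apply: eq_bigr => j _; rewrite mulrC -{1}star_mx_sym mxE.
  apply: contrapT => no; move/eqP: v0; apply; apply/rowP => i; rewrite mxE.
  by apply/eqP/negPn/negP => vi; apply: no; exists i.
move=> [v vl [i vi]]; apply/eigenvalueP; exists (\row_j v j).
  apply/rowP => j; rewrite !mxE -vl; apply: eq_bigr => k _.
  by rewrite mxE mulrC -{1}star_mx_sym mxE.
by apply: contraNneq vi => /rowP/(_ i); rewrite !mxE => ->.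
Qed.

(** An eigenvector of a nonzero eigenvalue has zero sum. Then either its entry at
    the center is nonzero and the eigenvalue is [w * n], or that entry vanishes and
    each leaf only sees its own entry. *)
Lemma star_eigenvalue l : eigenvalue star_mx l -> 0 < l -> l = w \/ l = w * n%:R.
Proof.
move=> /star_eigenvalueP[v vl [i vi]] l0.
pose S := \sum_j v j.
have {}vl k : w * (if k == c then n%:R * v c - S else v k - v c) = l * v k.
  by rewrite -vl star_mx_mul.
have S0 : S = 0.
  have : l * S = 0.
    rewrite mulr_sumr; under eq_bigr do rewrite -vl.
    rewrite -mulr_sumr (bigD1 c)//= eqxx.
    rewrite (eq_bigr (fun k => v k - v c)) => [|k kc]; last by rewrite (negPf kc).
    have -> : \sum_(k | k != c) (v k - v c) = \sum_k (v k - v c).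
      by rewrite [RHS](bigD1 c)//= subrr add0r.
    by rewrite sumrB sumr_const card_ord -[v c *+ n]mulr_natl -/S; ring.
  by move/eqP; rewrite mulf_eq0 gt_eqF//= => /eqP.
have [vc|vc] := eqVneq (v c) 0.
  left; have := vl i; have [ic|_] := eqVneq i c; first by rewrite ic vc eqxx in vi.
  by rewrite vc subr0 => /(mulIf vi).
right; have := vl c; rewrite eqxx S0 subr0 mulrA => /(mulIf vc) //.
Qed.

Lemma star_eigenvalue_center : (1 < n)%N -> eigenvalue star_mx (w * n%:R).
Proof.
move=> n1; apply/star_eigenvalueP.
exists (fun i => 1 - n%:R * (i == c)%:R) => [i|]; last first.
  by exists c; rewrite eqxx mulr1 subr_eq0 -[1]/(1%:R) eqr_nat; lia.
rewrite star_mx_mul -mulrA; congr (_ * _); rewrite eqxx.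
have -> : \sum_j (1 - n%:R * (j == c)%:R) = 0 :> R.
  rewrite sumrB sumr_const card_ord -mulr_sumr (bigD1 c)//= eqxx big1 => [|j jc].
    by rewrite addr0 mulr1 subrr.
  by rewrite (negPf jc).
by case: eqP => _; rewrite ?mulr1n ?mulr0n; ring.
Qed.

Lemma star_eigenvalue_leaf a b : a != b -> a != c -> b != c -> eigenvalue star_mx w.
Proof.
move=> ab ac bc; apply/star_eigenvalueP.
exists (fun i => (i == a)%:R - (i == b)%:R) => [i|]; last first.
  by exists a; rewrite eqxx (negPf ab) subr0 oner_eq0.
rewrite star_mx_mul; congr (_ * _).
rewrite [c == a]eq_sym [c == b]eq_sym (negPf ac) (negPf bc) subr0 mulr0 subr0.
case: eqP => [->|//]; rewrite [c == a]eq_sym [c == b]eq_sym (negPf ac) (negPf bc).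
have S (k : 'I_n) : \sum_j (j == k)%:R = 1 :> R.
  by rewrite (bigD1 k)//= eqxx big1 ?addr0// => j jk; rewrite (negPf jk).
by rewrite sumrB !S !subrr.
Qed.

Lemma star_lambda a b : a != b -> a != c -> b != c ->
  mx_lambda_min_pos star_mx w /\ mx_lambda_max star_mx (w * n%:R).
Proof.
move=> ab ac bc; have n1 : (1 < n)%N.
  by move: ab; case: a b {ac bc} => [i ?] [j ?]; rewrite -val_eqE /=; lia.
have wn : w <= w * n%:R by rewrite ler_peMr ?(ltW w_gt0)// ler1n ltnW.
split; split=> /=.
- by split => //; exact: star_eigenvalue_leaf ab ac bc.
- by move=> l [/star_eigenvalue h /h[]->].
- exact: star_eigenvalue_center.
- move=> l /star_eigenvalue h; have [/h[]->//|l0] := ltP 0 l.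
  by rewrite (le_trans l0)// mulr_ge0// ltW.
Qed.

End Star.

(** * The hard instance *)

Section Partner.

(** The matching of the chain indices: [{0, 1}, {2, 3}, ...] for [false] and
    [{1, 2}, {3, 4}, ...] for [true], where [0] is alone. *)
Definition partner (b : bool) k := if odd k (+) b then k.-1 else k.+1.

Lemma partnerK b : involutive (partner b).
Proof.
by case: b => -[|k]; rewrite /partner //=; case E: (odd k); rewrite /= ?E.
Qed.

(** A level whose parity is [b] cuts no pair of the matching. *)
Lemma partner_ge b l k : odd l = b -> (l <= k)%N -> (l <= partner b k)%N.
Proof. by rewrite /partner => <-; case: ifP; lia. Qed.

Lemma partner_ge_pred b k : (k.-1 <= partner b k)%N.
Proof. by rewrite /partner; case: ifP; lia. Qed.

Lemma partner_true_gt0 k : (0 < k)%N -> (0 < partner true k)%N.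
Proof. by rewrite /partner; case: ifP; lia. Qed.

End Partner.

Section Instance.
Variables (R : realType) (s t m : nat) (mu beta rho cc sa su : R).

Local Notation d := m.+2.

(** The two matchings of the chain are held by opposite thirds of the agents and
    of the blocks, so that two consecutive progresses along the chain are separated
    by a trip through the middle agents and one through the middle blocks. Thirds,
    rather than single agents and blocks, keep the strength of the chain
    proportional to the strong convexity of all the copies. *)
Definition active (i p : nat) : bool :=
  (i < s)%N && (p < t)%N ||
  (2 * s <= i)%N && ((2 * t <= p.+1)%N && (p < m)%N).

Definition flip (i j : nat) := (partner (i < s)%N (j %/ d) * d + j %% d)%N.

Lemma flip_cell i k (p : 'I_d) :
  flip i (k * d + p) = (partner (i < s)%N k * d + p)%N.
Proof. by rewrite /flip cell_div cell_mod. Qed.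

Lemma flipK i : involutive (flip i).
Proof.
by move=> j; have [k [p ->]] := cellP m.+1 j; rewrite !flip_cell partnerK.
Qed.

Lemma involutive_id : involutive (@id nat). Proof. by []. Qed.

(** The Hessian of half the sum of the squared differences over the matched pairs. *)
Definition chain_op i (x : l2 R) : l2 R :=
  coord_pick (fun j => active i (j %% d)%N) involutive_id x -
  coord_pick (fun j => active i (j %% d)%N) (flipK i) x.

Lemma chain_opE i x k (p : 'I_d) : chain_op i x (k * d + p)%N =
  if active i p then x (k * d + p)%N - x (partner (i < s)%N k * d + p)%N else 0.
Proof.
rewrite /chain_op l2_coordD l2_coordN !coord_pickE cell_mod flip_cell.
by case: ifP; rewrite ?subrr.
Qed.

Fact chain_op_linear i : linear (chain_op i).
Proof.
move=> a x y; rewrite /chain_op.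
have lin w f fK : @coord_pick R w f fK (a *: x + y) =
    a *: coord_pick w fK x + coord_pick w fK y by exact: linearP.
by rewrite !lin opprD addrACA -scalerBr.
Qed.

HB.instance Definition _ i :=
  GRing.isLinear.Build R (l2 R) (l2 R) _ (chain_op i) (chain_op_linear i).

Lemma chain_op_sqr i x : chain_op i (chain_op i x) = 2 *: chain_op i x.
Proof.
apply: (@cell_ext m.+1) => k p; rewrite l2_coordZ !chain_opE; case: (active i p).
  by rewrite partnerK; ring.
by rewrite mulr0.
Qed.

Lemma chain_op_sym i x y : inner (chain_op i x) y = inner x (chain_op i y).
Proof.
rewrite /chain_op innerDl innerDr innerNl innerNr !inner_pickl.
congr (_ - inner _ _); apply: (@cell_ext m.+1) => k p.
by rewrite !coord_pickE flip_cell !cell_mod.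
Qed.

Lemma zero01 : (0 : R) <= (0 : R) < (1 : R). Proof. by rewrite lexx ltr01. Qed.

(** The linear term that makes index [0] of the chain nonzero at the solution. *)
Definition source (i : nat) : l2 R :=
  if (i < s)%N then - cc *: geo m.+1 (fun p => p < t)%N zero01 else 0.

Lemma sourceE i k (p : 'I_d) : source i (k * d + p)%N =
  if (i < s)%N && (p < t)%N then - cc * 0 ^+ k else 0.
Proof.
rewrite /source; case: ifP => // _; rewrite l2_coordZ geoE andTb.
by case: ifP; rewrite ?mulr1 ?mulr0.
Qed.

Definition hard_cost i : l2 R -> R := quad (chain_op i) mu beta (source i) 0.

Fact op_adj_proof (i : 'I_(3 * s)) x y :
  inner (block_op (path_mx m sa su) x) y = inner x (block_op (path_mx m sa su)^T y).
Proof. exact: inner_block_op. Qed.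

Definition hard_problem : affine_problem R (3 * s) := {|
  cost := fun i => hard_cost i;
  op := fun=> block_op (path_mx m sa su);
  adj := fun=> block_op (path_mx m sa su)^T;
  rhs := fun=> 0;
  op_bounded := fun=> @block_op_continuous _ _ _;
  op_adj := op_adj_proof |}.

Lemma hard_cost_smooth_convex (i : 'I_(3 * s)) : 0 <= beta ->
  smooth (mu + 2 * beta) (cost hard_problem i) /\
  strongly_convex mu (cost hard_problem i).
Proof.
move=> beta_ge0.
split; first exact: quad_smooth (chain_op_sqr i) (chain_op_sym i) _ _ _ _ beta_ge0.
exact: quad_strongly_convex (chain_op_sqr i) (chain_op_sym i) _ _ _ _ beta_ge0.
Qed.

Hypothesis rho01 : 0 <= rho < 1.

Definition hard_solution : l2 R := geo m.+1 (fun p => p < m)%N rho01.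

Lemma path_block_opE x k (p : 'I_d) : block_op (path_mx m sa su) x (k * d + p)%N =
  if (p.+1 < m)%N then x (k * d + p)%N - x (k * d + p.+1)%N
  else if (p < m)%N then 0
  else (if p == m :> nat then sa else su) * x (k * d + p)%N.
Proof. by rewrite block_opE (path_mx_mul sa su (fun q => x (k * d + q)%N)). Qed.

Lemma hard_solution_feasible : feasible hard_problem (fun=> hard_solution).
Proof.
split=> // i; apply: (@cell_ext m.+1) => k p.
rewrite [LHS]path_block_opE /hard_solution l2_coord0 geoE.
case: ifP => pm.
  have p1 : (p.+1 < d)%N by rewrite (ltn_trans pm)// ltnS leqnSn.
  by rewrite (geoE _ _ k (Ordinal p1)) /= (ltnW pm) pm subrr.
by case: (ltnP p m) => // _; rewrite !mulr0.
Qed.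

(** The orthogonal projection onto the kernel of the constraint. *)
Definition mean_mx : 'M[R]_d := \matrix_(p, q) (((p < m)%N && (q < m)%N)%:R / m%:R).

Lemma mean_block_opE x k (p : 'I_d) : block_op mean_mx x (k * d + p)%N =
  (p < m)%N%:R / m%:R * \sum_(q < m) x (k * d + q)%N.
Proof.
rewrite block_opE; have le : (m <= d)%N by rewrite leqW.
rewrite (big_ord_widen _ (fun q => x (k * d + q)%N) le) mulr_sumr big_mkcond /=.
rewrite [RHS]big_mkcond /=; apply: eq_bigr => q _; rewrite mxE.
by case: (p < m)%N; case: (q < m)%N => /=; rewrite ?mul0r ?mulr0 ?mul0r.
Qed.

Definition grad_at_solution i : l2 R :=
  quad_grad (chain_op i) mu beta (source i) hard_solution.

Lemma grad_at_solutionE i k q : (q < m)%N -> grad_at_solution i (k * d + q)%N =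
  mu * rho ^+ k
  + (i < s)%N%:R * (q < t)%N%:R *
      (beta * (rho ^+ k - rho ^+ partner true k) - cc * 0 ^+ k)
  + ((2 * s <= i)%N && (2 * t <= q.+1)%N)%:R *
      (beta * (rho ^+ k - rho ^+ partner false k)).
Proof.
move=> qm; have qd : (q < d)%N by clear - qm; lia.
have -> j : grad_at_solution i j =
    mu * hard_solution j + beta * chain_op i hard_solution j + source i j by [].
rewrite -[q]/(val (Ordinal qd)) chain_opE sourceE !geoE /= qm !mulr1 /active qm andbT.
case: (ltnP i s) => is_ /=.
  have -> : (2 * s <= i)%N = false by clear - is_; lia.
  by case: (q < t)%N => /=; rewrite ?mul1r ?mul0r ?mulr0 ?addr0 //; ring.
by case: (2 * s <= i)%N => /=; case: (2 * t <= q.+1)%N => /=; ring.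
Qed.

Lemma sum_ord_lt (N a : nat) : (a <= N)%N -> \sum_(i < N) (i < a)%N%:R = a%:R :> R.
Proof.
move=> aN; rewrite -[in RHS](card_ord a) -sumr_const (big_ord_widen N (fun=> 1))//.
by rewrite [RHS]big_mkcond; apply: eq_bigr => i _; case: ifP.
Qed.

Lemma sum_ord_ge (N a : nat) : (a <= N)%N ->
  \sum_(i < N) (a <= i)%N%:R = (N - a)%:R :> R.
Proof.
move=> aN; rewrite natrB// -(sum_ord_lt aN).
have -> : N%:R = \sum_(i < N) 1 :> R by rewrite sumr_const card_ord.
rewrite -sumrB; apply: eq_bigr => i _.
by rewrite ltnNge; case: (a <= i)%N; rewrite ?subr0 ?subrr.
Qed.

Hypothesis mE : m.+1 = (3 * t)%N.
Hypothesis rho_root : 3 * m%:R * mu * rho + t%:R * beta * (2 * rho - 1 - rho ^+ 2) = 0.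
Hypothesis ccE : t%:R * cc = 3 * m%:R * mu + t%:R * beta * (1 - rho).

(** Summed over agents and blocks, the gradients give the recurrence whose
    decaying solution is geometric with ratio [rho]. *)
Lemma sum_grad_mean0 : block_op mean_mx (\sum_(i < 3 * s) grad_at_solution i) = 0.
Proof.
apply: (@cell_ext m.+1) => k p; rewrite mean_block_opE l2_coord0.
apply/eqP; rewrite mulf_eq0; apply/orP; right; apply/eqP.
under eq_bigr => q _ do rewrite l2_coord_sum.
under eq_bigr => q _.
  under eq_bigr do rewrite grad_at_solutionE//.
  rewrite !big_split /= sumr_const card_ord -!mulr_suml sum_ord_lt; last by lia.
  over.
rewrite !big_split /= sumr_const card_ord -mulr_suml -mulr_sumr sum_ord_lt; last by lia.
rewrite -mulr_suml exchange_big /=.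
under eq_bigr => i _.
  under eq_bigr => q _ do rewrite -mulnb natrM.
  rewrite -mulr_sumr.
  have -> : \sum_(q < m) (2 * t <= q.+1)%N%:R = t%:R :> R.
    have -> : t = (m - (2 * t).-1)%N by lia.
    rewrite -sum_ord_ge; last by lia.
    by apply: eq_bigr => q _; congr (_%:R); congr nat_of_bool; lia.
  over.
rewrite -mulr_suml sum_ord_ge; last by lia.
have -> : (3 * s - 2 * s = s)%N by lia.
rewrite -[mu * _ *+ (3 * s)]mulr_natl -[_ * _ *+ m]mulr_natl natrM.
case: k => [|k].
  rewrite /partner /= !expr0 expr1.
  transitivity (s%:R * (3 * m%:R * mu + t%:R * beta * (1 - rho) - t%:R * cc)).
    by ring.
  by rewrite ccE subrr mulr0.
rewrite expr0n mulr0 subr0.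
transitivity (s%:R * rho ^+ k *
    (3 * m%:R * mu * rho + t%:R * beta * (2 * rho - 1 - rho ^+ 2))).
  by rewrite /partner /=; case: (odd k) => /=; rewrite !exprS; ring.
by rewrite rho_root mulr0.
Qed.

Hypotheses (m_gt0 : (0 < m)%N) (sa_neq0 : sa != 0) (su_neq0 : su != 0).

Let mR : m%:R != 0 :> R. Proof. by rewrite pnatr_eq0 -lt0n. Qed.

(** The feasible directions are equal in the blocks of the path and vanish in the
    two further blocks. *)
Lemma kernel_mean h : block_op (path_mx m sa su) h = 0 -> block_op mean_mx h = h.
Proof.
move=> Ah; have {}Ah k (p : 'I_d) := congr1 (fun x : l2 R => x (k * d + p)%N) Ah.
have const k q : (q < m)%N -> h (k * d + q)%N = h (k * d + 0)%N.
  elim: q => // q IH qm; rewrite -(IH (ltnW qm)).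
  have qd : (q < d)%N by clear - qm; lia.
  have := Ah k (Ordinal qd); rewrite path_block_opE l2_coord0 /= qm => /eqP.
  by rewrite subr_eq0 => /eqP.
apply: (@cell_ext m.+1) => k p; rewrite mean_block_opE.
rewrite (eq_bigr (fun=> h (k * d + 0)%N)) => [|q _]; last exact: const.
rewrite sumr_const card_ord; have [pm|mp] := ltnP p m.
  by rewrite (const _ _ pm) -[h _ *+ m]mulr_natl mulrA divfK// mul1r.
rewrite !mul0r; have := Ah k p; rewrite path_block_opE l2_coord0 ltnNge leqW//= ltnNge mp/=.
move/eqP; rewrite mulf_eq0; case: ifP => _; first by rewrite (negPf sa_neq0) => /eqP.
by rewrite (negPf su_neq0) => /eqP.
Qed.

(** Strong convexity bounds the total cost below by its linearization, whose
    gradient is orthogonal to the feasible directions: it has zero mean over the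
    blocks of the path, while those directions are constant there. *)
Lemma hard_solution_optimal : (0 < s)%N -> 0 <= mu -> 0 <= beta ->
  is_solution hard_problem (fun=> hard_solution).
Proof.
move=> s_gt0 mu_ge0 beta_ge0; split; first exact: hard_solution_feasible.
move=> y [Ay y_eq]; have n_gt0 : (0 < 3 * s)%N by rewrite muln_gt0.
pose h := y (Ordinal n_gt0) - hard_solution.
have Ah : block_op (path_mx m sa su) h = 0.
  have e1 : block_op (path_mx m sa su) (y (Ordinal n_gt0)) = 0 := Ay _.
  have e2 : block_op (path_mx m sa su) hard_solution = 0.
    exact: (hard_solution_feasible.1 (Ordinal n_gt0)).
  transitivity (block_op (path_mx m sa su) (y (Ordinal n_gt0)) -
    block_op (path_mx m sa su) hard_solution); first exact: linearB.
  by rewrite e1 e2 subrr.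
have mean_sym : mean_mx^T = mean_mx by apply/matrixP => p q; rewrite !mxE andbC.
have orth : inner (\sum_(i < 3 * s) grad_at_solution i) h = 0.
  by rewrite -(kernel_mean Ah) -mean_sym -inner_block_op sum_grad_mean0 inner0l.
have : \sum_(i < 3 * s) (hard_cost i hard_solution + inner (grad_at_solution i) h)
    <= \sum_(i < 3 * s) cost hard_problem i (y i).
  apply: ler_sum => i _; rewrite (y_eq i (Ordinal n_gt0)).
  have [_ sc] := (hard_cost_smooth_convex i beta_ge0).2.
  apply: le_trans (sc hard_solution _ (grad_at_solution i) _); last first.
    exact: quad_gradient (chain_op_sqr i) (chain_op_sym i) _ _ _ _ _.
  by rewrite lerDl mulr_ge0 ?sqr_ge0// divr_ge0.
by rewrite big_split /= -inner_suml orth addr0.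
Qed.

End Instance.

(** * How far an algorithm reaches along the chain *)

Section Span.
Variables (R : realType) (V : lmodType R).

Lemma span_sub (S U : set V) : U 0 -> (forall a u v, U u -> U v -> U (a *: u + v)) ->
  S `<=` U -> Defs.span S `<=` U.
Proof.
move=> U0 Ulin SU _ [k [c [v [Sv ->]]]].
by elim/big_ind: _ => // [x y Ux Uy|i _];
  [rewrite -[x]scale1r; exact: Ulin | rewrite -[_ *: _]addr0; exact/Ulin/U0/SU].
Qed.

End Span.

Section Phases.
Variables (s t m : nat).

(** Communication [q] belongs to phase [q %/ s]. In each phase one outer third of the
    agents may be one index ahead, and the agents that catch up are the centers
    used during the phase: a leaf only hears the center as it was before the
    round, so the opposite third learns nothing until a center serves again. *)
Definition comm_level (q i : nat) : nat :=
  (q %/ s + ((if odd (q %/ s) then 2 * s <= i else i < s) ||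
             ((s <= i) && (i < s + q %% s))))%N.

(** Multiplication [q] belongs to phase [q %/ t]; in each phase the outer third of
    the blocks that is one index ahead invades the middle one block at a time. *)
Definition mult_level (q p : nat) : nat :=
  (q %/ t + (if odd (q %/ t) then 2 * t <= p.+1 + q %% t else p < t + q %% t))%N.

Lemma comm_level_le q i : (comm_level q i <= (q %/ s).+1)%N.
Proof. by rewrite /comm_level; lia. Qed.

Lemma mult_level_le q p : (mult_level q p <= (q %/ t).+1)%N.
Proof. by rewrite /mult_level; case: ifP; lia. Qed.

Lemma phase_succ q n : (0 < n)%N ->
  [/\ q.+1 %/ n = q %/ n, q.+1 %% n = (q %% n).+1 & (q %% n).+1 < n]%N \/
  [/\ q.+1 %/ n = (q %/ n).+1, q.+1 %% n = 0 & (q %% n).+1 = n]%N.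
Proof.
move=> n0; have um := ltn_pmod q n0.
have qE : (q.+1 = q %/ n * n + (q %% n).+1)%N by rewrite addnS -divn_eq.
have dE : (q.+1 %/ n = q %/ n + (q %% n).+1 %/ n)%N by rewrite [in LHS]qE divnMDl.
have mE' : (q.+1 %% n = (q %% n).+1 %% n)%N by rewrite [in LHS]qE modnMDl.
have [un|un] := ltnP (q %% n).+1 n; [left|right].
  by rewrite dE mE' (divn_small un) (modn_small un) addn0.
have {}un : (q %% n).+1 = n by apply/eqP; rewrite eqn_leq un um.
by rewrite dE mE' un divnn modnn n0 addn1.
Qed.

Lemma comm_level_step q (i j : nat) : (0 < s)%N ->
  i = (s + q %% s)%N \/ j = (s + q %% s)%N \/ i = j ->
  (comm_level q j <= comm_level q.+1 i)%N.
Proof.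
move=> s_gt0 ij; have us := ltn_pmod q s_gt0; rewrite /comm_level.
move: ij us; case: (phase_succ q s_gt0) => -[-> -> /=].
  case: (odd _); lia.
case: (odd _) => /=; lia.
Qed.

Lemma mult_level_step q (i j : nat) : (0 < t)%N -> (i <= j.+1)%N -> (j <= i.+1)%N ->
  (mult_level q j <= mult_level q.+1 i)%N.
Proof.
move=> t_gt0 ij ji; have us := ltn_pmod q t_gt0; rewrite /mult_level.
move: ij ji us; case: (phase_succ q t_gt0) => -[-> -> /=].
  case: (odd _); lia.
case: (odd _) => /=; lia.
Qed.

(** The parity is what makes computations useless within a phase: the third that is
    ahead has closed its pairs, and the opposite third has closed its own. *)
Lemma comm_level_parity q i p : (0 < s)%N -> active s t m i p ->
  odd (comm_level q i) = (i < s)%N.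
Proof.
move=> s_gt0; have us := ltn_pmod q s_gt0.
rewrite /active /comm_level oddD; case: (odd _) => /= act_p.
  by rewrite oddb; lia.
by rewrite oddb; lia.
Qed.

Lemma mult_level_parity q i p : (0 < t)%N -> active s t m i p ->
  odd (mult_level q p) = (i < s)%N.
Proof.
move=> t_gt0; have ut := ltn_pmod q t_gt0.
rewrite /active /mult_level oddD; case: (odd _) => /= act_p.
  by rewrite oddb; lia.
by rewrite oddb; lia.
Qed.

End Phases.

Section Levels.
Variables (R : realType) (s t m : nat) (mu beta cc sa su : R).

Local Notation d := m.+2.
Local Notation P := (hard_problem s t m mu beta cc sa su).

Definition below (l : nat -> nat) : set (l2 R) :=
  [set x | forall k (p : 'I_d), (l p <= k)%N -> x (k * d + p)%N = 0].

Lemma below_span (l : nat -> nat) S : S `<=` below l -> Defs.span S `<=` below l.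
Proof.
apply: span_sub => [k p _ //|a x y xl yl k p lk].
by rewrite l2_coordD l2_coordZ xl// yl// mulr0 addr0.
Qed.

Lemma below_sub (l l' : nat -> nat) : (forall p, (l p <= l' p)%N) -> below l `<=` below l'.
Proof. by move=> ll' x xl k p lk; apply: xl; exact: leq_trans lk. Qed.

(** An iterate that has not reached index [K] of the chain misses at least the
    coordinate [K] of the solution. *)
Lemma below_error (rho : R) (rho01 : 0 <= rho < 1) (l : nat -> nat) K x : (0 < m)%N ->
  below l x -> (forall p, (l p <= K)%N) ->
  rho ^+ (2 * K) <= `|x - hard_solution m rho01| ^+ 2.
Proof.
move=> m_gt0 xl lK; rewrite sqr_l2_norm.
apply: le_trans (le_sqr_inner _ (K * d + (ord0 : 'I_d))%N).
rewrite l2_coordD l2_coordN (xl _ _ (lK _)) sub0r sqrrN geoE /=.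
by rewrite m_gt0 mulr1 -exprM mulnC.
Qed.

(** The gradients of a cost and of its conjugate only mix the two coordinates of a
    pair of the matching of the agent. *)
Lemma quad_grad_eq0 (a g : R) (b : l2 R) i (x : l2 R) k (p : 'I_d) :
  x (k * d + p)%N = 0 -> b (k * d + p)%N = 0 ->
  (active s t m i p -> x (partner (i < s)%N k * d + p)%N = 0) ->
  quad_grad (chain_op s t m i) a g b x (k * d + p)%N = 0.
Proof.
move=> x0 b0 xp0.
have -> j : quad_grad (chain_op s t m i) a g b x j =
  a * x j + g * chain_op s t m i x j + b j by [].
rewrite chain_opE x0 b0 mulr0 add0r addr0; case: ifP => act_p; rewrite ?mulr0//.
by rewrite xp0// subrr mulr0.
Qed.

Hypotheses (mu_gt0 : 0 < mu) (beta_ge0 : 0 <= beta).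
Variables (G : nat -> rel 'I_(3 * s)) (alg : algorithm_run P G (fun=> 0)).

(** A level function [lev tau i p] bounds the chain indices that agent [i] has
    reached in block [p] after [tau] actions, as soon as it grows enough at every
    action. *)
Lemma memory_below (lev : nat -> nat -> nat -> nat) :
  (forall tau i p, (lev tau i p <= lev tau.+1 i p)%N) ->
  (forall tau i p k, act alg tau = Computation -> active s t m i p ->
    (lev tau.+1 i p <= k)%N -> (lev tau i p <= partner (i < s)%N k)%N) ->
  (forall tau i p, act alg tau = Computation -> (i < s)%N -> (p < t)%N ->
    (0 < lev tau.+1 i p)%N) ->
  (forall tau (i j : 'I_(3 * s)) p, act alg tau = Communication ->
    G (nb_actions (act alg) Communication tau) i j ->
    (lev tau j p <= lev tau.+1 i p)%N) ->
  (forall tau i p q, act alg tau = Multiplication ->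
    (p <= q.+1)%N -> (q <= p.+1)%N -> (lev tau i q <= lev tau.+1 i p)%N) ->
  forall tau (i : 'I_(3 * s)), memory alg tau i `<=` below (lev tau i).
Proof.
move=> mono part src comm mult; elim=> [|tau IH] i.
  by rewrite memory0 => _ -> k p _.
apply: (subset_trans (@memoryS _ _ _ _ _ alg tau i)); apply: below_span.
rewrite subUset; split; first exact: subset_trans (IH i) (below_sub (mono tau i)).
case E: (act alg tau) => /=; apply: below_span.
- have src0 k (p : 'I_d) : (lev tau.+1 i p <= k)%N ->
      source s t m cc i (k * d + p)%N = 0 /\
      source s t m cc i (partner (i < s)%N k * d + p)%N = 0.
    move=> lk; rewrite !sourceE; case: ifP => // /andP[is_ pt].
    have k0 : (0 < k)%N by rewrite (leq_trans (src _ _ _ E is_ pt) lk).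
    by rewrite is_ !expr0n !eqn0Ngt k0 partner_true_gt0// mulr0.
  have xp0 x k (p : 'I_d) : below (lev tau i) x -> (lev tau.+1 i p <= k)%N ->
      active s t m i p -> x (partner (i < s)%N k * d + p)%N = 0.
    by move=> xl lk act_p; apply: xl; exact: part.
  have x0 x k (p : 'I_d) : below (lev tau i) x -> (lev tau.+1 i p <= k)%N ->
      x (k * d + p)%N = 0.
    by move=> xl lk; apply: xl; exact: leq_trans lk.
  move=> y [x /IH xl [->|/(quad_gradientE (chain_op_sqr s t m i) (chain_op_sym s t m i)) ->|
      /(fenchel_quad_gradient (chain_op_sqr s t m i) (chain_op_sym s t m i)
          mu_gt0 beta_ge0) ->
    ]] k p lk.
  + exact: x0.
  + apply: quad_grad_eq0 => [||act_p]; [exact: x0 | exact: (src0 _ _ lk).1 | exact: xp0].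
  + have [s0 sp0] := src0 _ _ lk.
    apply: quad_grad_eq0 => [||act_p] //; rewrite l2_coordD l2_coordN ?s0 ?sp0 subr0.
      exact: x0.
    exact: xp0.
- move=> y [j Gij /IH yl] k p lk; apply: yl; apply: leq_trans lk.
  exact: comm.
- move=> y [->|->|[x /IH xl ->]] k p lk //.
    by rewrite -[block_op _ 0]/(block_op _ _) linear0.
  transitivity (block_op (path_gram m sa su) x (k * d + p)%N); first by rewrite block_op_mul.
  rewrite block_opE big1// => q _.
  have [->|Mpq] := eqVneq (path_gram m sa su p q) 0; first by rewrite mul0r.
  have /andP[pq qp] := path_gram_neq0 Mpq.
  by rewrite xl ?mulr0//; apply: leq_trans lk; exact: mult.
Qed.

Lemma nb_actionsS k a :
  nb_actions (act alg) a k.+1 = (nb_actions (act alg) a k + (act alg k == a))%N.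
Proof. by rewrite /nb_actions big_ord_recr. Qed.

(** Matched indices are consecutive, so a computation extends the reach by one. *)
Lemma computation_level tau (i : 'I_(3 * s)) :
  memory alg tau i `<=` below (fun=> nb_actions (act alg) Computation tau).
Proof.
apply: (memory_below (lev := fun tau _ _ => nb_actions (act alg) Computation tau)) => {tau i}.
- by move=> tau i p; rewrite nb_actionsS leq_addr.
- move=> tau i p k E _; rewrite nb_actionsS E eqxx addn1 => lk.
  by apply: leq_trans (partner_ge_pred _ _); clear - lk; lia.
- by move=> tau i p E _ _; rewrite nb_actionsS E eqxx addn1.
- by move=> tau i j p _ _; rewrite nb_actionsS leq_addr.
- by move=> tau i p q _ _ _; rewrite nb_actionsS leq_addr.
Qed.

Lemma communication_level tau (i : 'I_(3 * s)) : (0 < s)%N ->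
  (forall q (j k : 'I_(3 * s)), G q j k ->
    j = (s + q %% s)%N :> nat \/ k = (s + q %% s)%N :> nat) ->
  memory alg tau i `<=`
    below (fun=> comm_level s (nb_actions (act alg) Communication tau) i).
Proof.
move=> s_gt0 Gstar.
pose lev tau i (p : nat) := comm_level s (nb_actions (act alg) Communication tau) i.
apply: (memory_below (lev := lev)) => {tau i}; rewrite /lev.
- move=> tau i _; rewrite nb_actionsS; case: (_ == _); rewrite ?addn0// addn1.
  by apply: (comm_level_step s_gt0); right; right.
- move=> tau i p k E act_p; rewrite nb_actionsS E addn0.
  exact/partner_ge/(comm_level_parity _ s_gt0 act_p).
- move=> tau i p E is_ pt; rewrite lt0n.
  have act_p : active s t m i p by rewrite /active is_ pt.
  apply: contraTneq is_ => l0.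
  by have := comm_level_parity (nb_actions (act alg) Communication tau.+1) s_gt0 act_p;
    rewrite l0 => <-.
- move=> tau i j p E /Gstar Gij; rewrite nb_actionsS E addn1.
  by apply: (comm_level_step s_gt0); case: Gij; [left | right; left].
- move=> tau i _ _ E _ _; by rewrite nb_actionsS E addn0.
Qed.

Lemma multiplication_level tau (i : 'I_(3 * s)) : (0 < t)%N ->
  memory alg tau i `<=`
    below (mult_level t (nb_actions (act alg) Multiplication tau)).
Proof.
move=> t_gt0.
pose lev tau (i : nat) := mult_level t (nb_actions (act alg) Multiplication tau).
apply: (memory_below (lev := lev)) => {tau i}; rewrite /lev.
- move=> tau i p; rewrite nb_actionsS; case: (_ == _); rewrite ?addn0// addn1.
  by apply: (mult_level_step _ t_gt0).
- move=> tau i p k E act_p; rewrite nb_actionsS E addn0.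
  exact/partner_ge/(mult_level_parity _ t_gt0 act_p).
- move=> tau i p E is_ pt; rewrite lt0n.
  have act_p : active s t m i p by rewrite /active is_ pt.
  apply: contraTneq is_ => l0.
  by have := mult_level_parity (nb_actions (act alg) Multiplication tau.+1) t_gt0 act_p;
    rewrite l0 => <-.
- by move=> tau i j p E _; rewrite nb_actionsS E addn0.
- move=> tau i p q E pq qp; rewrite nb_actionsS E addn1.
  exact: (mult_level_step _ t_gt0).
Qed.

End Levels.

(** * The rates *)

Section Rates.
Variable R : realType.

(** The recurrence [M z_k + B (2 z_k - z_(k-1) - z_(k+1)) = 0] has a decaying
    geometric solution, whose ratio is at least [exp (- 2 sqrt (M / B))] when
    [M <= B]. *)
Lemma decay_ratio (M B : R) : 0 < M -> 0 <= B ->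
  exists rho : R, [/\ 0 <= rho < 1,
    M * rho + B * (2 * rho - 1 - rho ^+ 2) = 0 &
    M <= B -> 0 < rho /\ - ln rho <= 2 * Num.sqrt (M / B)].
Proof.
move=> M0 B0; pose S := Num.sqrt (M ^+ 2 + 4 * M * B).
have S0 : 0 <= S by exact: sqrtr_ge0.
have SS : S ^+ 2 = M ^+ 2 + 4 * M * B.
  by rewrite sqr_sqrtr// addr_ge0 ?sqr_ge0// mulr_ge0// mulr_ge0// ltW.
have D0 : 0 < M + 2 * B + S by lra.
have Dn : M + 2 * B + S != 0 by rewrite gt_eqF.
exists (2 * B / (M + 2 * B + S)); split.
- by rewrite divr_ge0 ?mulr_ge0 ?(ltW D0)//= ltr_pdivrMr// mul1r; lra.
- suff -> : forall r, r = 2 * B / (M + 2 * B + S) ->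
    M * r + B * (2 * r - 1 - r ^+ 2) =
    B * (M ^+ 2 + 4 * M * B - S ^+ 2) / (M + 2 * B + S) ^+ 2.
      by rewrite SS subrr mulr0 mul0r.
    by [].
  by move=> r ->; field.
- move=> MB; have {}B0 : 0 < B by lra.
  split; first by rewrite divr_gt0// mulr_gt0.
  pose x := Num.sqrt (M / B); rewrite -/x.
  have x0 : 0 <= x by exact: sqrtr_ge0.
  have ME : M = x ^+ 2 * B.
    by rewrite sqr_sqrtr ?divr_ge0 ?(ltW M0) ?(ltW B0)// divfK// gt_eqF.
  have x1 : x <= 1.
    rewrite -ler_sqr ?nnegrE// expr1n.
    by rewrite -(ler_pM2r B0) -ME mul1r.
  have xB : 0 <= x * B by rewrite mulr_ge0// ltW.
  have MxB : M <= x * B by rewrite ME expr2 -mulrA ler_piMl.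
  have S3 : S <= 3 * (x * B).
    have xB3 : 0 <= 3 * (x * B) by rewrite mulr_ge0.
    rewrite -ler_sqr ?nnegrE// SS.
    have -> : (3 * (x * B)) ^+ 2 = 4 * M * B + 5 * (x ^+ 2 * B) * B.
      by rewrite ME; ring.
    rewrite -ME addrC lerD2l expr2.
    apply: (@le_trans _ _ (M * B)); first by rewrite ler_pM2l.
    by rewrite ler_pM2r// ler_peMl ?(ltW M0)// ler1n.
  rewrite -lnV ?posrE ?divr_gt0 ?mulr_gt0// invf_div.
  have -> : (M + 2 * B + S) / (2 * B) = 1 + (M + S) / (2 * B).
    by field; rewrite gt_eqF.
  have y0 : 0 <= (M + S) / (2 * B).
    by rewrite divr_ge0 ?addr_ge0 ?mulr_ge0 ?(ltW M0) ?(ltW B0).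
  apply: le_trans (le_ln1Dx _) _; first by rewrite (lt_le_trans _ y0)// ltrN10.
  by rewrite ler_pdivrMr ?mulr_gt0//; lra.
Qed.

Lemma reach_needed (rho sk eps : R) K : 0 < rho -> - ln rho <= 12 / sk -> 0 < sk ->
  0 < eps -> rho ^+ (2 * K) <= eps -> sk * ln (1 / eps) / 24 <= K%:R.
Proof.
move=> rho0 lnr sk0 eps0 le_eps.
have : ln (rho ^+ (2 * K)) <= ln eps by rewrite ler_ln ?posrE ?exprn_gt0.
rewrite lnXn// -[ln rho *+ _]mulr_natl natrM div1r lnV// => h.
rewrite ler_pdivrMr// -ler_pdivlMl//.
have : K%:R * - ln rho <= K%:R * (12 / sk) by rewrite ler_wpM2l.
have -> : sk^-1 * (K%:R * 24) = 2 * (K%:R * (12 / sk)) by ring.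
lra.
Qed.

Lemma truncn_third (x : R) : 3 <= x ->
  [/\ (0 < Num.truncn (x / 3))%N, (3 * Num.truncn (x / 3))%:R <= x &
      x / 6 <= (Num.truncn (x / 3))%:R].
Proof.
move=> x3; have x0 : 0 <= x / 3 by rewrite divr_ge0//; lra.
have /andP[] := truncn_itv x0; have : (0 < Num.truncn (x / 3))%N.
  by rewrite truncn_gt0; lra.
move: (Num.truncn _) => n n0; have : 1 <= n%:R :> R by rewrite ler1n.
by rewrite -(natr1 n) natrM; split=> //; lra.
Qed.

(** A third of the length of the path. As the path has less than [3 * t] nodes, the
    factor [6] makes [4 * m ^ 2 <= chiA] when [t > 1]; at least two nodes are always
    kept, so that each progress still needs a multiplication. *)
Definition path_third (chiA : R) : nat := maxn 1 (Num.truncn (Num.sqrt chiA / 6)).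

Lemma path_third_bounds chiA : 1 <= chiA ->
  Num.sqrt chiA / 12 <= (path_third chiA)%:R <= Num.sqrt chiA.
Proof.
move=> c1; have q1 : 1 <= Num.sqrt chiA by rewrite -[1]sqrtr1 ler_wsqrtr.
have q0 : 0 <= Num.sqrt chiA / 6 by rewrite divr_ge0//; lra.
have /andP[le] := truncn_itv q0.
move: le; rewrite /path_third; move: (Num.truncn _) => n le; rewrite -(natr1 n) => lt.
have n0 : 0 <= n%:R :> R by [].
have [n1|n1] := ltnP 1 n.
  have : 2 <= n%:R :> R by rewrite ler_nat.
  by move=> ?; apply/andP; split; lra.
have : n%:R <= 1 :> R by rewrite -[1]/(1%:R) ler_nat.
by move=> ?; apply/andP; split; lra.
Qed.

Lemma path_third_sqr chiA : 1 <= chiA -> (1 < path_third chiA)%N ->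
  36 * (path_third chiA)%:R ^+ 2 <= chiA.
Proof.
rewrite /path_third => c1 t1; have -> : maxn 1 (Num.truncn (Num.sqrt chiA / 6)) =
  Num.truncn (Num.sqrt chiA / 6) by lia.
have q0 : 0 <= Num.sqrt chiA / 6 by rewrite divr_ge0// sqrtr_ge0.
have /andP[le _] := truncn_itv q0.
have c0 : 0 <= chiA by lra.
rewrite -[leRHS](sqr_sqrtr c0).
have -> : Num.sqrt chiA ^+ 2 = 36 * (Num.sqrt chiA / 6) ^+ 2 by field.
by rewrite ler_pM2l// ler_pXn2r ?nnegrE.
Qed.

End Rates.

Section Gram.
Variables (R : realType) (s t m : nat) (mu beta cc al chiA : R).
Hypotheses (s_gt0 : (0 < s)%N) (al_gt0 : 0 < al) (chiA_ge1 : 1 <= chiA).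

Local Notation sa := (Num.sqrt al).
Local Notation su := (Num.sqrt (al * chiA)).

Lemma hard_gram_spectrum :
  (forall l, eigenvalue (path_gram m sa su) l -> 0 < l -> al <= l <= al * chiA) ->
  let P := hard_problem s t m mu beta cc sa su in
  op_lambda_min_pos (block_gram P) al /\ op_lambda_max (block_gram P) (al * chiA).
Proof.
move=> bnd P.
have -> : block_gram P = @block_map R m.+1 (3 * s) (path_gram m sa su).
  apply/funext => x; apply/funext => i.
  by rewrite /block_map block_op_mul.
have n_gt0 : (0 < 3 * s)%N by lia.
have al0 : 0 <= al := ltW al_gt0.
have u0 : 0 <= al * chiA := mulr_ge0 al0 (le_trans ler01 chiA_ge1).
have pm : (m < m.+2)%N by lia.
have pm1 : (m.+1 < m.+2)%N by lia.
have e1 : op_eigenvalue (@block_map R m.+1 (3 * s) (path_gram m sa su)) al.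
  apply: (block_eigenvalue (Ordinal n_gt0) (p := Ordinal pm)) => q.
  by rewrite path_gram_extra//= eqxx sqr_sqrtr.
have e2 : op_eigenvalue (@block_map R m.+1 (3 * s) (path_gram m sa su)) (al * chiA).
  apply: (block_eigenvalue (Ordinal n_gt0) (p := Ordinal pm1)) => q.
  rewrite path_gram_extra//=; have -> : (m.+1 == m) = false by lia.
  by rewrite sqr_sqrtr.
split; split => //; split=> /=.
- by split => //; exact: eigenvalue_spectrum.
- by move=> l [/block_spectrum /bnd h /h /andP[]].
- exact: eigenvalue_spectrum.
- move=> l /block_spectrum /bnd h; have [/h /andP[]//|l0] := ltP 0 l.
  exact: le_trans u0.
Qed.

End Gram.

(** The path of the instance can be as long as [sqrt chiA] while its positive
    spectrum stays within a window of ratio [chiA]: on [m] nodes that spectrum lies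
    between [1 / m ^ 2] and [4]. For small [chiA] the path has two nodes, and its
    only positive eigenvalue is [2]. *)
Lemma path_window (R : realType) (chiA : R) : 1 <= chiA ->
  exists (t m : nat) (al : R),
  [/\ (0 < t)%N, m.+1 = (3 * t)%N,
      Num.sqrt chiA / 12 <= t%:R <= Num.sqrt chiA, 0 < al &
      forall l, eigenvalue (path_gram m (Num.sqrt al) (Num.sqrt (al * chiA))) l ->
        0 < l -> al <= l <= al * chiA].
Proof.
move=> c1; have t0 : (0 < path_third chiA)%N by rewrite leq_maxl.
have := path_third_bounds c1; have := path_third_sqr c1.
move: (path_third chiA) t0 => t t0 t_sqr t_bounds.
exists t, (3 * t).-1; have mE : (3 * t).-1.+1 = (3 * t)%N by rewrite prednK// muln_gt0.
move: (3 * t).-1 mE => m mE.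
have m0 : 0 < m%:R :> R by rewrite ltr0n; clear - t0 mE; lia.
pose al : R := if t == 1%N then 2 else m%:R ^- 2.
have al0 : 0 < al by rewrite /al; case: ifP => // _; rewrite invr_gt0 exprn_gt0.
exists al; split=> // l el l0.
have alc : al <= al * chiA by rewrite ler_peMr// ltW.
have al0' : 0 <= al by exact: ltW.
have u0 : 0 <= al * chiA by exact: le_trans alc.
have [->|->|[/andP[ml l4] m2]] := path_gram_eigenvalue el l0.
- by rewrite sqr_sqrtr// lexx alc.
- by rewrite sqr_sqrtr// lexx alc.
have [t1|t1] := eqVneq t 1%N.
  have alE : al = 2 by rewrite /al t1.
  have -> : l = al by rewrite alE m2//; clear - mE t1; lia.
  by rewrite lexx alc.
have alE : al = m%:R ^- 2 by rewrite /al (negPf t1).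
rewrite {1}alE ml (le_trans l4)// alE mulrC ler_pdivlMr ?exprn_gt0//.
have t2 : (1 < t)%N by clear - t0 t1; lia.
apply: le_trans (t_sqr t2).
have -> : 36 * t%:R ^+ 2 = 4 * (3 * t)%:R ^+ 2 :> R by rewrite natrM; ring.
by rewrite ler_pM2l// ler_pXn2r ?nnegrE// ler_nat -mE.
Qed.

(** Against the strong convexity [3 * m * mu] of all the copies, the chain couples
    neighbours with strength [t * beta], where [m < 3 * t] and [beta] is
    comparable to [L] when [L / mu] is large. *)
Lemma chain_decay (R : realType) (mu L : R) (t m : nat) (beta := (L - mu) / 2) :
  0 < mu -> mu <= L -> (0 < m)%N -> (m < 3 * t)%N ->
  exists rho : R, [/\ 0 <= rho < 1,
    3 * m%:R * mu * rho + t%:R * beta * (2 * rho - 1 - rho ^+ 2) = 0 &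
    36 <= L / mu -> 0 < rho /\ - ln rho <= 12 / Num.sqrt (L / mu)].
Proof.
move=> mu0 muL m0 mt.
have tR : 0 < t%:R :> R by rewrite ltr0n; case: t mt.
have mR : 0 < m%:R :> R by rewrite ltr0n.
have beta0 : 0 <= beta by rewrite divr_ge0// subr_ge0.
have M0 : 0 < 3 * m%:R * mu by rewrite !mulr_gt0.
have B0 : 0 <= t%:R * beta by rewrite mulr_ge0// ltW.
have [rho [rho01 rho_root rho_decay]] := decay_ratio M0 B0.
exists rho; split=> // kappa36; set sk := Num.sqrt (L / mu).
have Lmu0 : 0 < L / mu by exact: lt_le_trans kappa36.
have sk0 : 0 < sk by rewrite sqrtr_gt0.
have LE : L = sk ^+ 2 * mu by rewrite sqr_sqrtr ?(ltW Lmu0)// divfK// gt_eqF.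
have kmu : 36 * mu <= L by rewrite -ler_pdivlMr.
have beta_gt0 : 0 < beta by rewrite /beta; lra.
have tbeta_gt0 : 0 < t%:R * beta by rewrite mulr_gt0.
have MB : 3 * m%:R * mu / (t%:R * beta) <= (6 / sk) ^+ 2.
  have m3t : m%:R <= 3 * t%:R :> R by rewrite -natrM ler_nat ltnW.
  have b4 : sk ^+ 2 * mu <= 4 * beta by rewrite -LE /beta; lra.
  have sk2 : 0 < sk ^+ 2 by rewrite exprn_gt0.
  rewrite ler_pdivrMr// exprMn exprVn -(ler_pM2l sk2).
  have -> : sk ^+ 2 * (6 ^+ 2 * (sk ^+ 2)^-1 * (t%:R * beta)) = 9 * t%:R * (4 * beta).
    by field; rewrite gt_eqF.
  apply: (@le_trans _ _ (9 * t%:R * (sk ^+ 2 * mu))); last first.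
    by rewrite ler_pM2l// mulr_gt0.
  have -> : sk ^+ 2 * (3 * m%:R * mu) = 3 * m%:R * (sk ^+ 2 * mu) by ring.
  by rewrite ler_pM2r ?mulr_gt0//; lra.
have sk6 : 0 <= 6 / sk by rewrite divr_ge0// ltW.
have sk1 : (6 / sk) ^+ 2 <= 1.
  rewrite exprMn exprVn ler_pdivrMr ?exprn_gt0// mul1r sqr_sqrtr ?(ltW Lmu0)//.
  by apply: le_trans kappa36; lra.
have [|rho0 lnr] := rho_decay.
  by have := le_trans MB sk1; rewrite ler_pdivrMr// mul1r.
split=> //; apply: (le_trans lnr).
have -> : 12 / sk = 2 * (6 / sk) by ring.
rewrite ler_pM2l// -[leRHS]ger0_norm// -sqrtr_sqr.
exact: ler_wsqrtr.
Qed.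

(** Since [sk * ln (1 / eps) / 24] is at least [4], rounding it down and removing
    one costs at most half of it. *)
Lemma reach_threshold (R : realType) (rho sk eps : R) :
  0 < rho -> - ln rho <= 12 / sk -> 6 <= sk -> 0 < eps < expR (- 16) ->
  exists2 N : nat, Theta_with 48^-1 24^-1 N%:R (sk * ln (1 / eps)) &
    forall k, rho ^+ (2 * k) <= eps -> (N < k)%N.
Proof.
move=> rho0 lnrho sk6 /andP[eps0 eps16].
have sk0 : 0 < sk by exact: lt_le_trans sk6.
have lneps : 16 <= ln (1 / eps).
  by rewrite div1r lnV// lerNr -[leRHS]expRK ler_ln ?posrE ?expR_gt0// ltW.
have Y96 : 96 <= sk * ln (1 / eps).
  by apply: (@le_trans _ _ (6 * 16)); [lra | exact: ler_pM].
have reach k : rho ^+ (2 * k) <= eps -> sk * ln (1 / eps) / 24 <= k%:R.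
  exact: reach_needed.
move: (sk * ln (1 / eps)) Y96 reach => Y Y96 reach.
have X0 : 0 <= Y / 24 by lra.
have /andP[] := truncn_itv X0; have : (0 < Num.truncn (Y / 24))%N.
  by rewrite truncn_gt0; lra.
case: (Num.truncn _) => // N _; rewrite -(natr1 N.+1) -(natr1 N) => leX ltX.
exists N; first by apply/andP; split; lra.
move=> k /reach h; rewrite -(ltr_nat R); lra.
Qed.

Theorem theorem2 (R : realType) :
  exists c C kappa0 : R, [/\ 0 < c, 0 < C & 0 < kappa0] /\
  forall LF muF chiA lmin lmax chiW : R,
  0 < muF -> muF <= LF -> 1 <= chiA ->
  0 < lmin -> 0 < lmax -> lmax / lmin = chiW -> 3 <= chiW ->
  exists (n : nat) (P : affine_problem R n) (x0 : 'I_n -> l2 R)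
    (G : nat -> rel 'I_n) (W : nat -> 'M[R]_n) (xstar : l2 R),
  [/\ forall i, smooth LF (cost P i) /\ strongly_convex muF (cost P i),
      forall k, undirected_graph (G k) /\ gossip_matrix (G k) (W k),
      forall k, exists l u : R, [/\ mx_lambda_min_pos (W k) l,
        mx_lambda_max (W k) u, lmin <= l, l <= u & u <= lmax],
      exists l u : R, [/\ op_lambda_min_pos (block_gram P) l,
        op_lambda_max (block_gram P) u & u / l = chiA] &
      is_solution P (fun=> xstar)] /\
  (kappa0 <= LF / muF ->
   exists2 eps0 : R, 0 < eps0 &
   forall eps : R, 0 < eps < eps0 ->
   exists N Ncomm Nmult : nat,
   [/\ Theta_with c C N%:R (Num.sqrt (LF / muF) * ln (1 / eps)),
       Theta_with c C Ncomm%:R (N%:R * chiW) &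
       Theta_with c C Nmult%:R (N%:R * Num.sqrt chiA)] /\
   forall (alg : algorithm_run P G x0) (K : nat),
   (forall i, `|output alg K i - xstar| ^+ 2 <= eps) ->
   [/\ (N <= nb_actions (act alg) Computation K)%N,
       (Ncomm <= nb_actions (act alg) Communication K)%N &
       (Nmult <= nb_actions (act alg) Multiplication K)%N]).
Proof.
(* The smallest of the three lower constants is that of the computations: [1 / 24]
   from the decay of the solution, halved by rounding. *)
exists 48^-1, 1, 36; split; first by split=> //; lra.
move=> LF muF chiA lmin lmax chiW mu0 muL chiA1 lmin0 lmax0 chiWE chiW3.
have [s0 s3 s6] := truncn_third chiW3; move: (Num.truncn (chiW / 3)) s0 s3 s6 => s s0 s3 s6.
have [t [m [al [t0 mE /andP[t12 tA] al0 window]]]] := path_window chiA1.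
have m0 : (0 < m)%N by clear - t0 mE; lia.
have tR : 0 < t%:R :> R by rewrite ltr0n.
pose beta := (LF - muF) / 2.
have beta0 : 0 <= beta by rewrite divr_ge0// subr_ge0.
have LFE : LF = muF + 2 * beta by rewrite /beta; field.
have mt : (m < 3 * t)%N by rewrite -mE.
have [rho [rho01 rho_root rho_decay]] := chain_decay mu0 muL m0 mt.
pose cc := (3 * m%:R * muF + t%:R * beta * (1 - rho)) / t%:R.
have ccE : t%:R * cc = 3 * m%:R * muF + t%:R * beta * (1 - rho).
  by rewrite mulrC divfK// gt_eqF.
have center_lt q : (s + q %% s < 3 * s)%N by have := ltn_pmod q s0; clear; lia.
pose G q := star (Ordinal (center_lt q)).
have n1 : (1 < 3 * s)%N by clear - s0; lia.
exists (3 * s)%N, (hard_problem s t m muF beta cc (Num.sqrt al) (Num.sqrt (al * chiA))).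
exists (fun=> 0), G, (fun q => star_mx lmin (Ordinal (center_lt q))).
exists (hard_solution m rho01).
split.
  split.
  - by move=> i; rewrite {1}LFE; exact: hard_cost_smooth_convex.
  - by move=> q; split; [exact: star_undirected | exact: star_gossip].
  - move=> q; exists lmin, (lmin * (3 * s)%:R).
    have n0 : (0 < 3 * s)%N by exact: ltnW.
    have nm : ((3 * s).-1 < 3 * s)%N by rewrite prednK.
    have us := ltn_pmod q s0.
    have [] := @star_lambda R _ lmin (Ordinal (center_lt q)) lmin0
      (Ordinal n0) (Ordinal nm); rewrite -?val_eqE /=; try (move: us; clear - s0; lia).
    move=> lmn lmx; split=> //.
      by rewrite ler_peMr ?(ltW lmin0)// ler1n.
    have -> : lmax = lmin * chiW by rewrite -chiWE mulrC divfK// gt_eqF.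
    by rewrite ler_pM2l.
  - exists al, (al * chiA).
    have [] := @hard_gram_spectrum R s t m muF beta cc al chiA s0 al0 chiA1 window.
    by split=> //; rewrite mulrC mulKf// gt_eqF.
  - have u0 : 0 < al * chiA by rewrite mulr_gt0// (lt_le_trans ltr01).
    apply: hard_solution_optimal => //; rewrite ?(ltW mu0)// sqrtr_eq0 -ltNge //.
move=> kappa36; have [rho0 lnrho] := rho_decay kappa36.
exists (expR (- 16)); first exact: expR_gt0.
move=> eps eps_bnd; have /andP[eps0 _] := eps_bnd.
have sk6 : 6 <= Num.sqrt (LF / muF).
  have -> : 6 = Num.sqrt (6 ^+ 2) :> R by rewrite sqrtr_sqr ger0_norm.
  by rewrite ler_wsqrtr// (le_trans _ kappa36)// -natrX ler_nat.
have [N /andP[N_ge N_le] N_reach] := reach_threshold rho0 lnrho sk6 eps_bnd.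
have N0 : 0 <= N%:R :> R by [].
rewrite div1r in N_ge N_le; exists N, (N * s)%N, (N * t)%N; split.
  rewrite /Theta_with !mul1r !natrM; split; apply/andP; split.
  - exact: N_ge.
  - by clear - N_le N0; lra.
  - by rewrite mulrCA ler_wpM2l//; clear - s6 chiW3; lra.
  - by rewrite ler_wpM2l//; have := ler0n R s; rewrite natrM in s3; clear - s3; lra.
  - by rewrite mulrCA ler_wpM2l//; have := sqrtr_ge0 chiA; clear - t12; lra.
  - by rewrite ler_wpM2l.
(* One agent suffices: every level function bounds the reach of all agents. *)
move=> alg K close; have n0 : (0 < 3 * s)%N by exact: ltnW.
have mem := output_memory alg K (Ordinal n0).
have reach (l : nat -> nat) k : below m l (output alg K (Ordinal n0)) ->
    (forall p, (l p <= k)%N) -> (N < k)%N.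
  move=> ol lk; apply: N_reach.
  by apply: le_trans (close (Ordinal n0)); exact: (below_error _ m0 ol lk).
split.
- exact/ltnW/(reach _ _ (computation_level mu0 beta0 mem)).
- have star_center q (j k : 'I_(3 * s)) : G q j k ->
      j = (s + q %% s)%N :> nat \/ k = (s + q %% s)%N :> nat.
    by move=> /andP[_ /orP[/eqP ->|/eqP ->]]; [left|right].
  have := reach _ _ (communication_level mu0 beta0 s0 star_center mem)
    (fun=> comm_level_le s _ _).
  by rewrite ltnS leq_divRL.
- have := reach _ _ (multiplication_level mu0 beta0 t0 mem) (mult_level_le t _).
  by rewrite ltnS leq_divRL.
Qed.
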